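(* Let $r,\ell \ge 1$ be integers. If $M$ is a simple rank-$r$ positroid with no $U_{2,\ell+2}$-minor, then $|M| \le \ell(r-1)+1$. Moreover, if $r \ge 2$, then equality $|M| = \ell(r-1)+1$ holds if and only if $M$ can be obtained by taking parallel connections of copies of $U_{2,\ell+1}$, i.e. $M$ belongs to the smallest class of matroids that contains every matroid isomorphic to $U_{2,\ell+1}$ and is closed under forming parallel connections $P_e(M_1,M_2)$ of two members $M_1,M_2$ of the class with $E(M_1)\cap E(M_2)=\{e\}$.
   Context: A positroid is a matroid that can be represented (as the column matroid) by a full-rank real matrix all of whose maximal square subdeterminants are nonnegative. $|M|$ denotes the number of elements of the ground set of $M$. $U_{2,n}$ is the rank-$2$ uniform matroid on $n$ elements. A minor is a matroid obtained by a sequence of deletions and contractions (up to isomorphism). Given matroids $M_1, M_2$ with $E(M_1)\cap E(M_2)=\{e\}$, the parallel connection $P_e(M_1,M_2)$ is the matroid on $E(M_1)\cup E(M_2)$ whose flats are exactly the sets $F \subseteq E(M_1)\cup E(M_2)$ such that $F\cap E(M_1)$ is a flat of $M_1$ and $F \cap E(M_2)$ is a flat of $M_2$. *)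

(* Defs.v *)
From HB Require Import structures.
From mathcomp Require Import all_boot all_order all_algebra.
From mathcomp Require Import reals.

Set Implicit Arguments.
Unset Strict Implicit.
Unset Printing Implicit Defensive.

Import Order.TTheory GRing.Theory Num.Theory.

(* A matroid is given by a ground set inside an ambient finite type together   *)
(* with its family of independent sets; the ambient type plays no other role.  *)
Record matroid (T : finType) := Matroid {
  ground : {set T};
  indep : {set {set T}};
  indep_ground : forall I, I \in indep -> I \subset ground;
  indep0 : set0 \in indep;
  indepS : forall I J : {set T}, J \in indep -> I \subset J -> I \in indep;
  indep_aug : forall I J : {set T}, I \in indep -> J \in indep -> #|I| < #|J| ->
    exists2 x, x \in J :\: I & x |: I \in indep
}.

Section Basics.
Variables (T : finType) (M : matroid T).
Implicit Types (X I F : {set T}) (x y : T).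

Definition rank_of X : nat := \max_(I in indep M | I \subset X) #|I|.

Definition matroid_rank : nat := rank_of (ground M).

Definition matroid_closure X : {set T} :=
  [set x in ground M | rank_of (x |: X) == rank_of X].

Definition flat F : bool := (F \subset ground M) && (matroid_closure F == F).

Definition loop x : bool := (x \in ground M) && ([set x] \notin indep M).

Definition parallel x y : bool :=
  [&& x \in ground M, y \in ground M, ~~ loop x, ~~ loop y, x != y
    & [set x; y] \notin indep M].

Definition simple_matroid : Prop :=
  (forall x, ~~ loop x) /\ (forall x y, ~~ parallel x y).

Lemma indep_le_rank X I : I \in indep M -> I \subset X -> #|I| <= rank_of X.
Proof. by move=> iI sIX; rewrite /rank_of (bigD1 I) ?iI //= leq_maxl. Qed.

Lemma rank_of_le X n :
  (forall I, I \in indep M -> I \subset X -> #|I| <= n) -> rank_of X <= n.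
Proof. by move=> h; apply/bigmax_leqP => I /andP[]; apply: h. Qed.

Lemma rank_of_card X : rank_of X <= #|X|.
Proof. by apply: rank_of_le => I _; apply: subset_leq_card. Qed.

Lemma indep_extend X I : I \in indep M -> I \subset X ->
  exists B : {set T}, [/\ B \in indep M, I \subset B, B \subset X & #|B| = rank_of X].
Proof.
move=> iI sIX.
pose P := [pred B : {set T} | (B \in indep M) && (B \subset X)].
have PI : P I by rewrite /= iI.
have [B /maxsetP[/andP[iB sBX] maxB] sIB] := maxset_exists PI.
exists B; split=> //; apply/eqP; rewrite eqn_leq indep_le_rank //=.
apply: rank_of_le => J iJ sJX; rewrite leqNgt; apply/negP => ltBJ.
have [x /setDP[xJ xnB] ixB] := indep_aug iB iJ ltBJ.
have := maxB (x |: B); rewrite /= ixB subUset sub1set (subsetP sJX) // sBX.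
rewrite subsetUr => /(_ isT isT) eqB.
by move: xnB; rewrite -eqB setU11.
Qed.

Lemma rank_ofU X Y : rank_of (X :|: Y) <= #|X| + rank_of Y.
Proof.
apply: rank_of_le => I iI sI.
rewrite -(cardsID X I) leq_add ?subset_leq_card ?subsetIr //.
apply: indep_le_rank; first exact: indepS iI (subsetDl _ _).
by apply/subsetP => x /setDP[/(subsetP sI)/setUP[->|//]].
Qed.

End Basics.

Section Minors.
Variable T : finType.
Implicit Types (M N : matroid T) (C D I J : {set T}).

Section Delete.
Variables (M : matroid T) (D : {set T}).

Definition delete_indep := [set I in indep M | [disjoint I & D]].

Fact delete_ground I : I \in delete_indep -> I \subset ground M :\: D.
Proof. by rewrite inE subsetD => /andP[/indep_ground-> ->]. Qed.

Fact delete_indep0 : set0 \in delete_indep.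
Proof. by rewrite inE indep0 -setI_eq0 set0I eqxx. Qed.

Fact delete_indepS I J : J \in delete_indep -> I \subset J -> I \in delete_indep.
Proof.
rewrite !inE => /andP[iJ dJ] sIJ.
by rewrite (indepS iJ sIJ) (disjointWl sIJ dJ).
Qed.

Fact delete_aug I J : I \in delete_indep -> J \in delete_indep -> #|I| < #|J| ->
  exists2 x, x \in J :\: I & x |: I \in delete_indep.
Proof.
rewrite !inE => /andP[iI dI] /andP[iJ dJ] lt.
have [x xJI ixI] := indep_aug iI iJ lt; exists x => //.
rewrite inE ixI disjoints_subset subUset sub1set -disjoints_subset dI inE andbT.
by have /setDP[xJ _] := xJI; rewrite (disjointFr dJ xJ).
Qed.

Definition delete : matroid T :=
  Matroid delete_ground delete_indep0 delete_indepS delete_aug.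
End Delete.

Section Contract.
Variables (M : matroid T) (C : {set T}).

(* r_{M/C}(I) = r(I u C) - r(C), written without truncated subtraction.       *)
Definition contract_indep :=
  [set I : {set T} | (I \subset ground M :\: C)
                  && (rank_of M (I :|: C) == #|I| + rank_of M C)].

Fact contract_ground I : I \in contract_indep -> I \subset ground M :\: C.
Proof. by rewrite inE => /andP[]. Qed.

Fact contract_indep0 : set0 \in contract_indep.
Proof. by rewrite inE sub0set set0U cards0 eqxx. Qed.

Lemma contract_indepP (B : {set T}) : B \in indep M -> B \subset C ->
    #|B| = rank_of M C ->
  forall I, (I \in contract_indep) = (I \subset ground M :\: C) && (I :|: B \in indep M).
Proof.
move=> iB sBC cB I; rewrite inE; case sI: (I \subset _) => //=.
have [_ dIC] : I \subset ground M /\ [disjoint I & C].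
  by move: sI; rewrite subsetD => /andP[].
have dIB : I :&: B = set0.
  by apply/eqP; rewrite setI_eq0; apply: disjointWr dIC.
have cIB : #|I :|: B| = #|I| + rank_of M C by rewrite cardsU dIB cards0 subn0 cB.
apply/eqP/idP => [rk|iIB].
  have [B' [iB' sBB' sB' cB']] := indep_extend iB (subset_trans sBC (subsetUr I C)).
  suff sub : B' \subset I :|: B.
    by have /eqP<- // : B' == I :|: B by rewrite eqEcard sub cIB cB' rk /=.
  apply/subsetP => x xB'; rewrite inE.
  have /setUP[->//|xC] := subsetP sB' _ xB'.
  apply/orP; right; apply/negPn/negP => xnB.
  have ixB : x |: B \in indep M.
    by apply: indepS iB' _; rewrite subUset sub1set xB'.
  have := indep_le_rank (X := C) ixB; rewrite subUset sub1set xC sBC => /(_ isT).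
  by rewrite cardsU1 xnB cB add1n ltnn.
apply/eqP; rewrite eqn_leq rank_ofU -cIB.
by apply: indep_le_rank => //; apply: setUS.
Qed.

Fact contract_indepS I J : J \in contract_indep -> I \subset J -> I \in contract_indep.
Proof.
have [B [iB _ sBC cB]] := indep_extend (indep0 M) (sub0set C).
rewrite !(contract_indepP iB sBC cB) => /andP[sJ iJB] sIJ.
by rewrite (subset_trans sIJ sJ) (indepS iJB) // setSU.
Qed.

Fact contract_aug I J : I \in contract_indep -> J \in contract_indep ->
  #|I| < #|J| -> exists2 x, x \in J :\: I & x |: I \in contract_indep.
Proof.
have [B [iB _ sBC cB]] := indep_extend (indep0 M) (sub0set C).
rewrite !(contract_indepP iB sBC cB) => /andP[sI iIB] /andP[sJ iJB] lt.
have dB (K : {set T}) : K \subset ground M :\: C -> #|K :|: B| = #|K| + #|B|.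
  rewrite subsetD => /andP[_ dK]; rewrite cardsU.
  have /eqP-> : K :&: B == set0 by rewrite setI_eq0; apply: disjointWr dK.
  by rewrite cards0 subn0.
have lt' : #|I :|: B| < #|J :|: B| by rewrite !dB // ltn_add2r.
have [x /setDP[]] := indep_aug iIB iJB lt'.
rewrite !inE negb_or => /orP[xJ|->]; last by rewrite andbF.
move=> /andP[xnI _] ix; exists x; first by rewrite inE xnI.
by rewrite (contract_indepP iB sBC cB) -setUA ix subUset sub1set (subsetP sJ) ?sI.
Qed.

Definition contract : matroid T :=
  Matroid contract_ground contract_indep0 contract_indepS contract_aug.
End Contract.

Inductive minor M : matroid T -> Prop :=
| minor_refl : minor M M
| minor_delete N D : minor M N -> minor M (delete N D)
| minor_contract N C : minor M N -> minor M (contract N C).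

End Minors.

Definition matroid_iso (T1 T2 : finType) (M1 : matroid T1) (M2 : matroid T2) : Prop :=
  exists f : {x : T1 | x \in ground M1} -> {x : T2 | x \in ground M2},
    bijective f /\
    forall X : {set {x : T1 | x \in ground M1}},
      (val @: X \in indep M1) = (val @: (f @: X) \in indep M2).

Definition has_minor (T1 T2 : finType) (M : matroid T1) (N : matroid T2) : Prop :=
  exists2 M' : matroid T1, minor M M' & matroid_iso M' N.

Section Uniform.
Variables k n : nat.

Definition uniform_indep := [set I : {set 'I_n} | #|I| <= k].

Fact uniform_ground I : I \in uniform_indep -> I \subset [set: 'I_n].
Proof. by rewrite subsetT. Qed.

Fact uniform_indep0 : set0 \in uniform_indep.
Proof. by rewrite inE cards0. Qed.

Fact uniform_indepS (I J : {set 'I_n}) :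
  J \in uniform_indep -> I \subset J -> I \in uniform_indep.
Proof. by rewrite !inE => cJ /subset_leq_card/leq_trans->. Qed.

Fact uniform_aug (I J : {set 'I_n}) :
  I \in uniform_indep -> J \in uniform_indep -> #|I| < #|J| ->
  exists2 x, x \in J :\: I & x |: I \in uniform_indep.
Proof.
rewrite !inE => _ cJ lt.
have /subsetPn[x xJ xnI] : ~~ (J \subset I).
  by apply: contraL lt => /subset_leq_card; rewrite -leqNgt.
by exists x; rewrite !inE ?xnI // cardsU1 xnI (leq_trans lt).
Qed.

Definition uniform : matroid 'I_n :=
  Matroid uniform_ground uniform_indep0 uniform_indepS uniform_aug.
End Uniform.

Section ColumnMatroid.
Variables (F : fieldType) (k n : nat) (A : 'M[F]_(k, n)).

Definition column_indep := [set I : {set 'I_n} | free [seq col j A | j <- enum I]].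

Fact column_ground I : I \in column_indep -> I \subset [set: 'I_n].
Proof. by rewrite subsetT. Qed.

Fact column_indep0 : set0 \in column_indep.
Proof. by rewrite inE enum_set0 nil_free. Qed.

Lemma column_free_U1 (I : {set 'I_n}) (j : 'I_n) : j \notin I ->
  free [seq col i A | i <- enum (j |: I)] = free (col j A :: [seq col i A | i <- enum I]).
Proof.
move=> jI; rewrite -[RHS]/(free [seq col i A | i <- j :: enum I]).
apply/perm_free/perm_map.
apply: uniq_perm; rewrite ?enum_uniq //= ?mem_enum ?jI ?enum_uniq //.
by move=> x; rewrite inE !mem_enum !inE.
Qed.

Fact column_indepS (I J : {set 'I_n}) :
  J \in column_indep -> I \subset J -> I \in column_indep.
Proof.
rewrite !inE => fJ sIJ.
have eqJ : perm_eq (enum J) (enum I ++ enum (J :\: I)).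
  apply: uniq_perm; rewrite ?enum_uniq // ?cat_uniq ?enum_uniq ?andbT /=.
    by apply/hasPn => x; rewrite !mem_enum => /setDP[].
  move=> x; rewrite mem_cat !mem_enum !inE.
  by case xI: (x \in I) => //=; rewrite (subsetP sIJ).
move: fJ; rewrite (perm_free (perm_map _ eqJ)) map_cat.
by apply: catl_free.
Qed.

Fact column_aug (I J : {set 'I_n}) :
  I \in column_indep -> J \in column_indep -> #|I| < #|J| ->
  exists2 x, x \in J :\: I & x |: I \in column_indep.
Proof.
rewrite !inE => fI fJ lt.
case: (boolP [exists x in J, col x A \notin <<[seq col j A | j <- enum I]>>%VS]).
  case/exists_inP => x xJ xsp.
  have xI : x \notin I.
    by apply: contra xsp => xI; apply/memv_span/mapP; exists x; rewrite ?mem_enum.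
  by exists x; rewrite !inE ?xI // column_free_U1 // free_cons xsp.
rewrite negb_exists_in => /forall_inP sp.
suff : #|J| <= #|I| by rewrite leqNgt lt.
move: fI fJ; rewrite /free !size_map -!cardE => /eqP<- /eqP<-.
apply/dimvS/span_subvP => v /mapP[x]; rewrite mem_enum => xJ ->.
by apply/negPn; apply: sp.
Qed.

Definition column_matroid : matroid 'I_n :=
  Matroid column_ground column_indep0 column_indepS column_aug.
End ColumnMatroid.

(* The columns of A carry the linear order of 'I_n, which matters for the      *)
(* signs of the minors; M is a positroid when its ground set can be labelled   *)
(* by the columns of some such A.                                              *)
Definition positroid (R : realType) (T : finType) (M : matroid T) : Prop :=
  exists (k n : nat) (A : 'M[R]_(k, n)),
    [/\ \rank A = k,
        forall f : 'I_k -> 'I_n, (forall i j : 'I_k, i < j -> f i < f j) ->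
          (0 <= \det (colsub f A))%R
      & matroid_iso M (column_matroid A)].

(* M is P_e(M1, M2); a matroid is determined by its ground set and its flats.  *)
Definition is_parallel_connection (T : finType) (e : T) (M1 M2 M : matroid T) : Prop :=
  [/\ ground M1 :&: ground M2 = [set e],
      ground M = ground M1 :|: ground M2
    & forall F : {set T},
        flat M F = [&& F \subset ground M1 :|: ground M2,
                       flat M1 (F :&: ground M1) & flat M2 (F :&: ground M2)]].

(* The smallest class of matroids containing all copies of N and closed under  *)
(* parallel connections. Working inside one ambient type T loses nothing:      *)
(* the ground sets of M1 and M2 are contained in that of P_e(M1, M2).          *)
Inductive parallel_connections_of (T0 : finType) (N : matroid T0) (T : finType) :
  matroid T -> Prop :=
| PC_copy M : matroid_iso M N -> parallel_connections_of N M
| PC_connect e M1 M2 M :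
    parallel_connections_of N M1 -> parallel_connections_of N M2 ->
    is_parallel_connection e M1 M2 M -> parallel_connections_of N M.

(* Main.v *)
Require Import Defs.
From mathcomp Require Import all_boot all_order all_algebra.
From mathcomp Require Import reals.
From mathcomp Require Import perm zify ring.

(* Let [pos] be the column order of a totally nonnegative representation. Comparing
   the signs of the maximal minors shows that if [a], [b], [c] are collinear and [p],
   [q] are coplanar with them, off their line, then [pos p] and [pos q] lie in the same
   cyclic gap of [pos a], [pos b], [pos c]; the same holds after any contraction. Hence
   the middle point [e] of a collinear triple of minimal span lies on only one line [L]
   with more than two points. Contracting [e] and simplifying loses [|L| - 1 <= l]
   elements and one unit of rank, which gives the bound by induction.

   In the case of equality, a hyperplane [H] with [l] elements outside is lifted from
   the simplified contraction. By the bound applied to contractions, every line through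
   two points outside [H] meets [H]; as M(K4) violates the gap condition, all points
   outside [H] lie on one line with a point [p] of [H], so [M] is the parallel
   connection at [p] of this line and the restriction of [M] to [H]. *)

Set Implicit Arguments.
Unset Strict Implicit.
Unset Printing Implicit Defensive.

Import Order.TTheory GRing.Theory Num.Theory.

Ltac set_solve := apply/setP => ?; rewrite !inE;
  do ?[case: (_ == _) => //=]; do ?[case: (_ \in _) => //=].
Ltac sub_solve := apply/subsetP => ?; rewrite !inE;
  do ?[case: (_ == _) => //=]; do ?[case: (_ \in _) => //=].
(** Splits on the order of two positions and at once discards the branches that contradict what is
    known, which keeps the case analysis in [no_K4_order] small. *)
Ltac compare_pos a b := case: (ltngtP a b) => //= ?;
  rewrite ?andbF ?orbF ?andbT ?orbT //=; try (exfalso; lia).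

(** * Rank functions and minors *)

Lemma setU1_idP (T : finType) (x : T) (X : {set T}) : x \in X -> x |: X = X.
Proof. by move=> xX; apply/setUidPr; rewrite sub1set. Qed.

Section Rank.
Variables (T : finType) (M : matroid T).
Implicit Types (X Y Z I F : {set T}) (x y : T).
Local Notation r := (rank_of M).

Lemma rank_ofS X Y : X \subset Y -> r X <= r Y.
Proof.
by move=> sXY; apply: rank_of_le => I iI sI; apply: indep_le_rank (subset_trans sI sXY).
Qed.

Lemma rank_of_basis X : exists I, [/\ I \in indep M, I \subset X & #|I| = r X].
Proof.
by have [B [iB _ sB cB]] := indep_extend (indep0 M) (sub0set X); exists B.
Qed.

Lemma rank_of_indep I : I \in indep M -> r I = #|I|.
Proof.
by move=> iI; apply/eqP; rewrite eqn_leq rank_of_card indep_le_rank.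
Qed.

Lemma indep_rank_of X : (X \in indep M) = (r X == #|X|).
Proof.
apply/idP/eqP => [|rX]; first exact: rank_of_indep.
have [I [iI sI cI]] := rank_of_basis X.
by have /eqP<- : I == X by rewrite eqEcard sI cI rX leqnn.
Qed.

Lemma rank_of0 : r set0 = 0.
Proof. by apply/eqP; rewrite -leqn0 -(cards0 T) rank_of_card. Qed.

Lemma rank_of_submod X Y : r (X :|: Y) + r (X :&: Y) <= r X + r Y.
Proof.
have [I [iI sI cI]] := rank_of_basis (X :&: Y).
have sIU : I \subset X :|: Y.
  by apply: subset_trans sI (subset_trans (subsetIl _ _) (subsetUl _ _)).
have [J [iJ sIJ sJ cJ]] := indep_extend iI sIU.
have hX : #|J :&: X| <= r X.
  by apply: indep_le_rank (subsetIr _ _); apply: indepS iJ (subsetIl _ _).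
have hY : #|J :&: Y| <= r Y.
  by apply: indep_le_rank (subsetIr _ _); apply: indepS iJ (subsetIl _ _).
apply: leq_trans (leq_add hX hY).
rewrite -cardsUI -setIUr (setIidPl sJ) cJ leq_add2l -cI subset_leq_card //.
rewrite !subsetI sIJ !andTb.
by move: sI; rewrite subsetI => /andP[-> ->].
Qed.

Lemma rank_ofU1 x X : r (x |: X) <= (r X).+1.
Proof. by have := rank_ofU M [set x] X; rewrite cards1. Qed.

Lemma rank_of1 x : r [set x] <= 1.
Proof. by have := rank_of_card M [set x]; rewrite cards1. Qed.

Lemma rank_of2 x y : r [set x; y] <= 2.
Proof. by apply: leq_trans (rank_of_card _ _) _; rewrite cards2; case: eqP. Qed.

(** Submodularity for [Z :|: X] and [Y]: what lies in the span of [X] lies in the span of every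
    larger set. Most span arguments below go through this. *)
Lemma rank_absorb X Y Z : X \subset Y -> r (Z :|: X) <= r X -> r (Z :|: Y) = r Y.
Proof.
move=> sXY h; apply/eqP; rewrite eqn_leq [X in _ && X]rank_ofS ?subsetUr // andbT.
have := rank_of_submod (Z :|: X) Y; rewrite -setUA (setUidPr sXY).
have : r X <= r ((Z :|: X) :&: Y) by apply: rank_ofS; rewrite subsetI subsetUr.
lia.
Qed.

Lemma rank_absorb_all X Z : (forall z, z \in Z -> r (z |: X) <= r X) -> r (Z :|: X) = r X.
Proof.
have [n le_n] := ubnP #|Z|; elim: n Z le_n => // n IHn Z leZ h.
have [->|[z zZ]] := set_0Vmem Z; first by rewrite set0U.
rewrite -(setD1K zZ) -setUA; have sub : X \subset (Z :\ z) :|: X by rewrite subsetUr.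
rewrite (rank_absorb sub (h z zZ)) IHn //.
  by rewrite (cardsD1 z) zZ add1n ltnS in leZ.
by move=> y /setD1P[_ /h].
Qed.

Lemma flatP F : reflect (F \subset ground M /\
   forall x, x \in ground M -> x \notin F -> r F < r (x |: F)) (flat M F).
Proof.
rewrite /flat; apply: (iffP andP) => [[sF /eqP eqF]|[sF h]]; split=> //.
  move=> x xE; rewrite -{1}eqF inE xE /= => ne.
  by rewrite ltn_neqAle eq_sym ne rank_ofS ?subsetUr.
apply/eqP/setP=> x; rewrite inE; apply/andP/idP => [[xE /eqP e]|xF].
  by apply/negPn/negP => /(h x xE); rewrite e ltnn.
by rewrite (subsetP sF) // setU1_idP // eqxx.
Qed.

Lemma sub_closure X : X \subset ground M -> X \subset matroid_closure M X.
Proof.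
by move=> sX; apply/subsetP => x xX; rewrite inE (subsetP sX) // setU1_idP // eqxx.
Qed.

Lemma rank_closure X : r (matroid_closure M X :|: X) = r X.
Proof. by apply: rank_absorb_all => z; rewrite inE => /andP[_ /eqP->]. Qed.

Lemma flat_closure X : X \subset ground M -> flat M (matroid_closure M X).
Proof.
move=> sX; apply/flatP; split; first by apply/subsetP => x /setIdP[].
have sub := sub_closure sX.
have rcl : r (matroid_closure M X) = r X by rewrite -{1}(setUidPl sub) rank_closure.
move=> x xE; rewrite inE xE /= => ne; rewrite rcl ltn_neqAle.
rewrite (leq_trans (rank_ofS (subsetUr [set x] X))) ?rank_ofS ?setUS // andbT.
apply: contra ne => /eqP e; rewrite eqn_leq.
by rewrite [X in _ && X]rank_ofS ?subsetUr // e rank_ofS ?setUS.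
Qed.

(** If a basis [I] of [X] missed [x], it would lie in [X :\ x], so that [X :\ x] and with it the
    flat [F] would span [x]. The criterion serves parallel connections, which are given by their
    flats. *)
Lemma indep_flats X : X \subset ground M ->
  (forall x, x \in X -> exists F, [/\ flat M F, X :\ x \subset F & x \notin F]) ->
  X \in indep M.
Proof.
move=> sX h; have [I [iI sI cI]] := rank_of_basis X.
suff /eqP<- : I == X by [].
rewrite eqEsubset sI; apply/subsetP => x xX; apply/negPn/negP => xI.
have [F [/flatP[_ fF] sF xF]] := h x xX.
have := fF x (subsetP sX _ xX) xF; rewrite ltnNge => /negP[].
have sub : X :\ x \subset F by [].
rewrite (rank_absorb sub) // setD1K // -cI; apply: indep_le_rank => //.
by rewrite subsetD1 sI.
Qed.

Lemma simpleP : simple_matroid M <->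
  (forall x, x \in ground M -> r [set x] = 1) /\
  (forall x y, x \in ground M -> y \in ground M -> x != y -> r [set x; y] = 2).
Proof.
split=> [[nl np]|[h1 h2]].
  have i1 x : x \in ground M -> [set x] \in indep M.
    by move=> xE; have := nl x; rewrite /loop xE /= => /negPn.
  split=> [x xE|x y xE yE ne]; first by rewrite (rank_of_indep (i1 x xE)) cards1.
  have := np x y; rewrite /parallel /loop xE yE ne !i1 //= => /negPn/rank_of_indep->.
  by rewrite cards2 ne.
split=> [x|x y]; first by rewrite /loop; case xE: (x \in _) => //=;
  rewrite negbK indep_rank_of h1 // cards1.
rewrite /parallel; case xE: (x \in _) => //=; case yE: (y \in _) => //=.
rewrite !negb_and; case: eqP => [|/eqP ne]; first by rewrite !orbT.
by rewrite (indep_rank_of [set x; y]) h2 // cards2 ne eqxx !orbT.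
Qed.

End Rank.

Section MinorRank.
Variable T : finType.
Implicit Types (M N : matroid T) (C D X : {set T}).

Lemma rank_of_delete M D X : rank_of (delete M D) X = rank_of M (X :\: D).
Proof.
apply/eqP; rewrite eqn_leq; apply/andP; split; apply: rank_of_le => I iI sI.
  by move: iI; rewrite inE => /andP[iI dI]; apply: indep_le_rank; rewrite // subsetD sI.
move: sI; rewrite subsetD => /andP[sI dI].
by apply: indep_le_rank; rewrite // inE iI.
Qed.

(** For the lower bound on the contracted rank, a basis [B] of [C] is extended to a basis [J] of
    [X :|: C]; then [J :\: B] is independent in the contraction. *)
Lemma rank_of_contract M C X :
  rank_of (contract M C) X + rank_of M C = rank_of M (X :|: C).
Proof.
have [B [iB sB cB]] := rank_of_basis M C.
apply/eqP; rewrite eqn_leq; apply/andP; split.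
  have [I [iI sI cI]] := rank_of_basis (contract M C) X; rewrite -cI.
  by move: iI; rewrite inE => /andP[_ /eqP<-]; apply: rank_ofS; rewrite setSU.
have sBX : B \subset X :|: C by apply: subset_trans sB (subsetUr _ _).
have [J [iJ sBJ sJ cJ]] := indep_extend iB sBX.
have dJB : (J :\: B) :&: C = set0.
  apply/eqP; rewrite setI_eq0; apply/pred0P => x /=; apply/negP => /andP[/setDP[xJ xB] xC].
  have ixB : x |: B \in indep M by apply: indepS iJ _; rewrite subUset sub1set xJ.
  have := indep_le_rank (X := C) ixB; rewrite subUset sub1set xC sB => /(_ isT).
  by rewrite cardsU1 xB cB add1n ltnn.
rewrite -cJ -cB -(cardsID B J) (setIidPr sBJ) addnC leq_add2r.
apply: indep_le_rank.
  rewrite (contract_indepP iB sB cB) subsetD (subset_trans (subsetDl _ _) (indep_ground iJ)).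
  rewrite -setI_eq0 dJB eqxx /=.
  by rewrite -{2}(setIidPr sBJ) setUC setID.
apply/subsetP => x xJB; have /setDP[/(subsetP sJ)/setUP[//|xC] _] := xJB.
by have := in_set0 x; rewrite -dJB inE xJB xC.
Qed.

Lemma minor_trans M N P : minor M N -> minor N P -> minor M P.
Proof.
move=> mN; elim=> // [P' D _|P' D _] h; [exact: minor_delete|exact: minor_contract].
Qed.

End MinorRank.

(** * Column matroids and brackets *)

Section ColumnBases.
Variables (F : fieldType) (k n : nat) (A : 'M[F]_(k, n)).
Local Open Scope ring_scope.

Lemma det_colsub_eq0 (f : 'I_k -> 'I_n) : ~ injective f -> \det (colsub f A) = 0.
Proof.
move=> ninj; have /injectivePn[i [j ne eqf]] : ~~ injectiveb f by apply/injectiveP.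
rewrite -det_tr; apply: (determinant_alternate ne) => l.
by rewrite !mxE eqf.
Qed.

(** A linear relation among the chosen columns is a kernel vector of the square submatrix, so both
    sides say that this submatrix is invertible. *)
Lemma det_colsub_indep (f : 'I_k -> 'I_n) : injective f ->
  (\det (colsub f A) != 0) = (f @: [set: 'I_k] \in column_indep A).
Proof.
move=> injf; rewrite inE.
have /(perm_map (fun j => col j A))/perm_free-> :
    perm_eq (enum (f @: [set: 'I_k])) [seq f i | i <- enum 'I_k].
  apply: uniq_perm => [||j]; [exact: enum_uniq | by rewrite map_inj_uniq ?enum_uniq |].
  rewrite mem_enum; apply/imsetP/mapP => -[i _ ->]; exists i => //.
  by rewrite mem_enum.
rewrite -map_comp; set t := map_tuple ((fun j => col j A) \o f) (ord_tuple k).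
have tE (i : 'I_k) : t`_i = col (f i) A by rewrite -tnth_nth tnth_map tnth_ord_tuple.
have sumE (c : 'I_k -> F) : \sum_(i < k) c i *: t`_i = colsub f A *m (\col_i c i).
  apply/colP => j; rewrite summxE mxE; apply: eq_bigr => i _.
  by rewrite tE !mxE mulrC.
rewrite -unitfE -[_ \is a _]/(colsub f A \in unitmx) -[map _ _]/(tval t).
apply/idP/freeP => [u c|fr].
  rewrite sumE => e i; have : \col_j c j = 0.
    by rewrite -(mulKmx u (\col_j c j)) e mulmx0.
  by move/colP/(_ i); rewrite !mxE.
rewrite -unitmx_tr -row_free_unit -kermx_eq0; apply/eqP/row_matrixP => i; rewrite row0.
set v := row i _; have vK : v *m (colsub f A)^T = 0 by rewrite /v -row_mul mulmx_ker row0.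
apply/rowP => j; rewrite [RHS]mxE; apply: (fr (fun j => v 0 j)); rewrite sumE.
have -> : \col_i0 v 0 i0 = v^T by apply/colP=> l; rewrite !mxE.
by apply: trmx_inj; rewrite trmx_mul trmxK vK trmx0.
Qed.

Lemma column_indep_card (I : {set 'I_n}) : I \in column_indep A -> (#|I| <= k)%N.
Proof.
rewrite inE /free => /eqP; rewrite size_map -cardE => <-.
by apply: leq_trans (dimvS (subvf _)) _; rewrite dimvf /dim /= muln1.
Qed.

Lemma column_matroid_rank : \rank A = k -> rank_of (column_matroid A) [set: 'I_n] = k.
Proof.
move=> rA; apply/eqP; rewrite eqn_leq; apply/andP; split.
  by apply: rank_of_le => I iI _; apply: column_indep_card.
have full : row_full A^T by rewrite /row_full mxrank_tr rA.
have injf := @fullrankfun_inj _ _ _ _ full.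
have := det_colsub_indep injf.
have -> : \det (colsub (fullrankfun full) A) != 0.
  rewrite -unitfE -[_ \is a _]/(_ \in unitmx) -unitmx_tr -row_full_unit.
  have -> : (colsub (fullrankfun full) A)^T = rowsub (fullrankfun full) A^T.
    by apply/matrixP=> i j; rewrite !mxE.
  exact: fullrowsub_full.
move/esym=> ib; have := @indep_le_rank _ (column_matroid A) [set: 'I_n] _ ib.
by rewrite card_imset // cardsT card_ord subsetT; apply.
Qed.

End ColumnBases.

(** * Signs of maximal minors with unordered columns *)

Section TotallyPositiveSign.
Variables (R : realFieldType) (k n : nat) (A : 'M[R]_(k, n)).
Local Open Scope ring_scope.
Hypothesis Apos : forall f : 'I_k -> 'I_n, (forall i j : 'I_k, (i < j)%N -> (f i < f j)%N) ->
          0 <= \det (colsub f A).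

(** The Vandermonde determinant at the column indices. For injective [f] its sign is that of the
    permutation sorting [f], and it factors explicitly when columns are adjoined. *)
Definition vdm (f : 'I_k -> 'I_n) : R :=
  \prod_(i < k) \prod_(j < k | (i < j)%N) ((f j)%:R - (f i)%:R).

Lemma vdmE f : vdm f = \det (colsub f (Vandermonde k (\row_(j < n) j%:R))).
Proof.
rewrite (_ : colsub _ _ = Vandermonde k (\row_j (f j)%:R)).
  by rewrite det_Vandermonde; apply: eq_bigr => i _; apply: eq_bigr => j _; rewrite !mxE.
by apply/matrixP => i j; rewrite !mxE.
Qed.

Lemma colsub_perm (B : 'M[R]_(k, n)) (f : 'I_k -> 'I_n) (s : 'S_k) :
  \det (colsub (f \o s) B) = (-1) ^+ s * \det (colsub f B).
Proof.
have -> : colsub (f \o s) B = colsub f B *m perm_mx s^-1.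
  rewrite -col_permE; apply/matrixP => i j; rewrite !mxE //.
by rewrite det_mulmx det_perm odd_permV mulrC.
Qed.

Lemma increasing_perm (f : 'I_k -> 'I_n) : injective f ->
  exists s : 'S_k, forall i j : 'I_k, (i < j)%N -> (f (s i) < f (s j))%N.
Proof.
move=> injf; pose E := enum (f @: [set: 'I_k]).
have sE : size E = k by rewrite -cardE card_imset // cardsT card_ord.
have srt : sorted (fun x y : 'I_n => (x < y)%N) E.
  apply: sorted_filter; first by move=> x y z; apply: ltn_trans.
  by rewrite -(@sorted_map _ _ val ltn) /= -enumT val_enum_ord iota_ltn_sorted.
have ex (i : 'I_k) : exists j : 'I_k, f j == tnth (in_tuple E) (cast_ord (esym sE) i).
  have : tnth (in_tuple E) (cast_ord (esym sE) i) \in E by apply: mem_tnth.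
  by rewrite mem_enum => /imsetP[j _ ->]; exists j.
pose g i := xchoose (ex i).
have gE i : f (g i) = tnth (in_tuple E) (cast_ord (esym sE) i) by apply/eqP/(xchooseP (ex i)).
have ginc (i j : 'I_k) : (i < j)%N -> (f (g i) < f (g j))%N.
  move=> lt; rewrite !gE; have x0 := f i.
  rewrite !(tnth_nth x0) /=; apply: (sorted_ltn_nth _ x0 srt) => //=.
  - by move=> x y z; apply: ltn_trans.
  - by rewrite inE sE.
  - by rewrite inE sE.
have ginj : injective g.
  move=> i j e; apply: val_inj; case: (ltngtP i j) => // /ginc; rewrite e ltnn //.
by exists (perm ginj) => i j /ginc; rewrite !permE.
Qed.

(** Reordering the columns multiplies both determinants by the same sign, so [f] may be sorted; then
    [vdm] is positive and the minor is nonnegative by hypothesis. *)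
Lemma colsub_sign f : \det (colsub f A) != 0 -> 0 < \det (colsub f A) * vdm f.
Proof.
move=> nz; have injf : injective f.
  apply/injectiveP; apply: contraNT nz => ninj.
  by apply/eqP/det_colsub_eq0 => /injectiveP inj; rewrite inj in ninj.
have [s incs] := increasing_perm injf.
have -> : \det (colsub f A) * vdm f = \det (colsub (f \o s) A) * vdm (f \o s).
  by rewrite !vdmE !colsub_perm mulrACA -signr_addb addbb mul1r.
apply: mulr_gt0; last first.
  by apply: prodr_gt0 => i _; apply: prodr_gt0 => j /incs lt; rewrite subr_gt0 ltr_nat.
by rewrite lt0r Apos // colsub_perm mulf_neq0 ?signr_eq0.
Qed.

End TotallyPositiveSign.

(** For [p], [q] distinct from three given points, [between _ p q] takes the same value on all three
    exactly when [p] and [q] lie in one cyclic gap of the three. *)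
Definition between (x p q : nat) : bool := (p < x < q) || (q < x < p).

Lemma between_lt0 (R : realFieldType) (x p q : nat) :
  between x p q = ((p%:R - x%:R) * (q%:R - x%:R) < 0 :> R)%R.
Proof.
rewrite mulr_lt0 !subr_eq0 !subr_lt0 !eqr_nat !ltr_nat /between.
by case: (ltngtP p x); case: (ltngtP q x).
Qed.

(** * Brackets with three free columns *)

Section Bracket.
Variables (m n : nat) (w : 'I_m -> 'I_n).

Definition triple (x y z : 'I_n) (i : 'I_3) : 'I_n :=
  match nat_of_ord i with 0 => x | 1 => y | _ => z end.

(** The columns [w] occur in every bracket, which amounts to contracting them; only the three front
    columns vary. *)
Definition adjoin3 x y z (i : 'I_(3 + m)) : 'I_n :=
  match split i with inl j => triple x y z j | inr j => w j end.

Lemma adjoin3_lshift x y z j : adjoin3 x y z (lshift m j) = triple x y z j.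
Proof. by rewrite /adjoin3 (unsplitK (inl j)). Qed.

Lemma adjoin3_rshift x y z j : adjoin3 x y z (rshift 3 j) = w j.
Proof. by rewrite /adjoin3 (unsplitK (inr j)). Qed.

Lemma adjoin3_image x y z :
  adjoin3 x y z @: [set: 'I_(3 + m)] = [set x; y; z] :|: w @: [set: 'I_m].
Proof.
apply/setP => u; rewrite inE; apply/imsetP/orP => [[i _ ->]|].
  rewrite -(splitK i); case: (split i) => j /=.
    rewrite adjoin3_lshift; left; rewrite /triple !inE.
    by case: (nat_of_ord j) => [|[|]]; rewrite eqxx ?orbT.
  by rewrite adjoin3_rshift; right; rewrite imset_f ?inE.
case=> [|/imsetP[j _ ->]]; last by exists (rshift 3 j); rewrite ?inE ?adjoin3_rshift.
rewrite !inE => /orP[/orP[]|] /eqP->.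
- by exists (lshift m (@Ordinal 3 0 isT)); rewrite ?inE ?adjoin3_lshift.
- by exists (lshift m (@Ordinal 3 1 isT)); rewrite ?inE ?adjoin3_lshift.
- by exists (lshift m (@Ordinal 3 2 isT)); rewrite ?inE ?adjoin3_lshift.
Qed.

Section Vandermonde.
Variable R : realFieldType.
Local Open Scope ring_scope.

(** The product splits into the pairs among the front columns, the mixed pairs, which give [g], and
    the pairs inside [w], which give [d]. *)
Lemma vdm_adjoin3 : exists g : 'I_n -> R, exists d : R, forall x y z : 'I_n,
  vdm R (adjoin3 x y z) =
   (y%:R - x%:R) * (z%:R - x%:R) * (z%:R - y%:R) * (g x * g y * g z) * d.
Proof.
exists (fun x => \prod_(j < m) ((w j)%:R - x%:R)), (vdm R w) => x y z; rewrite /vdm.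
rewrite big_split_ord /=; congr (_ * _); last first.
  apply: eq_bigr => i _; rewrite big_split_ord /= big_pred0 ?mul1r; last first.
    move=> j; apply/negbTE; rewrite -leqNgt.
    exact: leq_trans (ltnW (ltn_ord j)) (leq_addr _ _).
  by apply: eq_big => [j|j _]; rewrite ?ltn_add2l // !adjoin3_rshift.
have inner (i : 'I_3) : \prod_(j < 3 + m | (i < j)%N)
      ((adjoin3 x y z j)%:R - (adjoin3 x y z (lshift m i))%:R : R) =
    \prod_(j < 3 | (i < j)%N) ((triple x y z j)%:R - (triple x y z i)%:R) *
    \prod_(j < m) ((w j)%:R - (triple x y z i)%:R).
  rewrite big_split_ord /=; congr (_ * _).
    by apply: eq_bigr => j _; rewrite !adjoin3_lshift.
  apply: eq_big => [j|j _]; last by rewrite adjoin3_lshift adjoin3_rshift.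
  by rewrite (leq_trans (ltn_ord i)) ?leq_addr.
rewrite (eq_bigr _ (fun i _ => inner i)).
rewrite !big_ord_recl !big_ord0 /= 3!(big_mkcond (fun j : 'I_3 => (_ < j)%N)) /=.
rewrite !big_ord_recl !big_ord0 /= /triple /bump /=; ring.
Qed.

End Vandermonde.

Section GrassmannPlucker.
Variables (F : fieldType) (A : 'M[F]_(3 + m, n)).
Local Open Scope ring_scope.

Definition bracket x y z : F := \det (colsub (adjoin3 x y z) A).

Lemma colsub_adjoin3 (B : 'M[F]_(3 + m, n)) x y z :
  colsub (adjoin3 x y z) B = row_mx (colsub (triple x y z) B) (colsub w B).
Proof.
apply/matrixP => i j; rewrite -(splitK j) !mxE; case: (split j) => l /=.
  by rewrite adjoin3_lshift (unsplitK (inl l)) mxE.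
by rewrite adjoin3_rshift (unsplitK (inr l)) mxE.
Qed.

Lemma det33 (B : 'M[F]_3) : \det B =
  B 0 0 * (B 1 1 * B 2 2 - B 1 2 * B 2 1) - B 0 1 * (B 1 0 * B 2 2 - B 1 2 * B 2 0)
  + B 0 2 * (B 1 0 * B 2 1 - B 1 1 * B 2 0).
Proof.
(* Indexing the entries by natural numbers lets [ring] identify equal entries whose ordinals are
   built differently. *)
pose b (i j : nat) := B (inord i) (inord j).
have BE i j : B i j = b i j by rewrite /b !inord_val.
rewrite (expand_det_row _ 0) !big_ord_recl big_ord0 /cofactor.
rewrite !(expand_det_row _ 0) !big_ord_recl !big_ord0 /cofactor !det_mx11 !mxE /=.
by rewrite !BE /= /bump /=; ring.
Qed.

(** In the basis formed by the columns [a], [b], [p] and [w], the columns [w] are unit vectors, so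
    every bracket reduces to a 3 by 3 determinant in the first three coordinates. *)
Lemma bracket_coord a b p : bracket a b p != 0 ->
  exists d, exists v : 'I_n -> 'I_3 -> F, forall x y z, bracket x y z = d *
   (v x 0 * (v y 1 * v z 2 - v z 1 * v y 2) - v y 0 * (v x 1 * v z 2 - v z 1 * v x 2)
    + v z 0 * (v x 1 * v y 2 - v y 1 * v x 2)).
Proof.
set P := colsub (adjoin3 a b p) A => nz.
have uP : P \in unitmx by rewrite unitmxE unitfE.
pose B := invmx P *m A.
exists (bracket a b p), (fun x i => B (lshift m i) x) => x y z.
have AE : A = P *m B by rewrite /B mulKVmx.
have colE f : colsub f A = P *m colsub f B.
  by rewrite {1}AE; apply/matrixP => i j; rewrite !mxE; apply: eq_bigr => l _; rewrite !mxE.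
have B1 : colsub (adjoin3 a b p) B = 1%:M.
  by rewrite -[LHS](mulKmx uP) -colE -/P mulVmx.
have wB : colsub w B = col_mx 0 1%:M.
  move: B1; rewrite colsub_adjoin3 (@scalar_mx_block _ 3 m) block_mxEh.
  by case/eq_row_mx.
rewrite {1}/bracket colE det_mulmx -/(bracket a b p); congr (_ * _).
rewrite colsub_adjoin3 wB -[colsub (triple x y z) B]vsubmxK -block_mxEh.
rewrite det_lblock det1 mulr1 det33 !mxE /triple /=.
by [].
Qed.

(** In the coordinates of [bracket_coord] these three-term relations are polynomial identities
    between 3 by 3 determinants. *)
Lemma grassmann_plucker a b p : bracket a b p != 0 -> forall c q,
  bracket a b p * bracket a c q - bracket a b c * bracket a p q =
  bracket a b q * bracket a c p /\
  bracket a b p * bracket b c q - bracket a b c * bracket b p q =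
  bracket a b q * bracket b c p.
Proof.
by move=> /bracket_coord[d [v vE]] c q; rewrite !vE; split; ring.
Qed.

End GrassmannPlucker.
End Bracket.

(** * Noncrossing matroids *)

Section BracketSign.
Variables (R : realFieldType) (m n : nat) (A : 'M[R]_(3 + m, n)) (w : 'I_m -> 'I_n).
Local Open Scope ring_scope.
Hypothesis Apos : forall f : 'I_(3 + m) -> 'I_n,
  (forall i j : 'I_(3 + m), (i < j)%N -> (f i < f j)%N) -> 0 <= \det (colsub f A).
Local Notation br := (bracket w A).

Lemma pos_of_sqr (s y : R) : 0 < s ^+ 2 * y -> 0 < y.
Proof.
by move=> h; rewrite ltNge; apply/negP => y0; move: h; rewrite ltNge mulr_ge0_le0 ?sqr_ge0.
Qed.

(** As the bracket of [a], [b], [c] vanishes, the three-term relations read [br a b p * br a c q =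
    br a b q * br a c p] and [br a b p * br b c q = br a b q * br b c p]. So in the product of two
    sign conditions everything except [h b * h c], respectively [h a * h c], is a square, and the
    sign of [h] decides [between]. *)
Lemma bracket_between a b c p q :
  br a b c = 0 -> br a b p != 0 -> br a c p != 0 -> br b c p != 0 ->
  br a b q != 0 -> br a c q != 0 -> br b c q != 0 ->
  between a p q = between b p q /\ between a p q = between c p q.
Proof.
move=> abc0 abp acp bcp abq acq bcq.
have [/esym] := grassmann_plucker abp c q; rewrite abc0 !mul0r !subr0 => gp1 /esym gp2.
have [g [d vE]] := vdm_adjoin3 w R.
pose h (x : 'I_n) : R := (p%:R - x%:R) * (q%:R - x%:R).
have sgn x y : br x y p != 0 -> br x y q != 0 ->
    0 < br x y p * br x y q * (g p * g q) * (h x * h y).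
  move=> /(colsub_sign Apos) h1 /(colsub_sign Apos) h2; have := mulr_gt0 h1 h2.
  rewrite !vE -/(br x y p) -/(br x y q) => h3.
  apply: (@pos_of_sqr ((y%:R - x%:R) * (g x * g y * d))).
  by apply: etrans h3; congr (_ < _); rewrite /h; ring.
have s1 := sgn a b abp abq; have s2 := sgn a c acp acq; have s3 := sgn b c bcp bcq.
have hbc : 0 < h b * h c.
  apply: (@pos_of_sqr (br a b p * br a c q * (g p * g q) * h a)).
  have := mulr_gt0 s1 s2; apply: etrans; congr (_ < _).
  have -> : br a b p * br a b q * (g p * g q) * (h a * h b) *
     (br a c p * br a c q * (g p * g q) * (h a * h c)) =
     (br a b p * br a c q) * (br a b q * br a c p) * (g p * g q) ^+ 2 * h a ^+ 2 * (h b * h c).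
    ring.
  by rewrite gp1; ring.
have hac : 0 < h a * h c.
  apply: (@pos_of_sqr (br a b p * br b c q * (g p * g q) * h b)).
  have := mulr_gt0 s1 s3; apply: etrans; congr (_ < _).
  have -> : br a b p * br a b q * (g p * g q) * (h a * h b) *
     (br b c p * br b c q * (g p * g q) * (h b * h c)) =
     (br a b p * br b c q) * (br a b q * br b c p) * (g p * g q) ^+ 2 * h b ^+ 2 * (h a * h c).
    ring.
  by rewrite gp2; ring.
have same (x y : R) : 0 < x * y -> (x < 0) = (y < 0).
  move=> xy; apply/idP/idP => lt; first by rewrite -(nmulr_rgt0 y lt).
  by rewrite -(nmulr_rgt0 x lt) mulrC.
rewrite !(between_lt0 R) -!/(h _); rewrite (same _ _ hac); split=> //.
by rewrite (same _ _ hbc).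
Qed.

End BracketSign.

Lemma column_rank_le (F : fieldType) (k n : nat) (A : 'M[F]_(k, n)) X :
  rank_of (column_matroid A) X <= k.
Proof. by apply: rank_of_le => I iI _; apply: (@column_indep_card _ _ _ A). Qed.

Lemma bracket_neq0 (F : fieldType) (m n : nat) (A : 'M[F]_(3 + m, n)) (w : 'I_m -> 'I_n) x y z :
  (bracket w A x y z != 0)%R =
  (rank_of (column_matroid A) ([set x; y; z] :|: w @: [set: 'I_m]) == 3 + m).
Proof.
rewrite -adjoin3_image; set f := adjoin3 w x y z.
apply/idP/eqP => [nz|rk].
  have injf : injective f.
    apply/injectiveP; apply: contraNT nz => ninj.
    by apply/eqP/det_colsub_eq0 => /injectiveP inj; rewrite inj in ninj.
  move: nz; rewrite /bracket (det_colsub_indep _ injf) => ib.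
  by rewrite (@rank_of_indep _ (column_matroid A)) // card_imset // cardsT card_ord.
have cf : #|f @: [set: 'I_(3 + m)]| == #|[set: 'I_(3 + m)]|.
  rewrite eqn_leq leq_imset_card cardsT card_ord /=.
  by apply: leq_trans (rank_of_card (column_matroid A) _); rewrite rk.
have injf : injective f by move=> i j; apply: (imset_injP cf); rewrite inE.
rewrite /bracket (det_colsub_indep _ injf).
have := indep_rank_of (column_matroid A) (f @: [set: 'I_(3 + m)]).
by rewrite /= => ->; rewrite rk (eqP cf) cardsT card_ord.
Qed.

(** A basis of [C] is extended by [S] and then to a basis [B] of [M]; the part [W] of [B] outside
    [S] spans [C]. Contracting [W] instead of [C] leaves rank exactly [#|S|], as brackets
    require. *)
Lemma indep_coextend (T : finType) (M : matroid T) (C S : {set T}) :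
  rank_of M (S :|: C) = #|S| + rank_of M C ->
  exists W : {set T}, [/\ #|W| + #|S| = rank_of M setT,
    rank_of M (C :|: W) = rank_of M W & rank_of M (S :|: W) = rank_of M setT].
Proof.
move=> rS; have [I [iI sI cI]] := rank_of_basis M C.
have [B0 [iB0 sIB0 sB0 cB0]] := indep_extend iI (subset_trans sI (subsetUr S C)).
have [B [iB sB _ cB]] := indep_extend iB0 (subsetT B0).
have le1 : #|B0 :&: C| <= rank_of M C.
  by apply: indep_le_rank (subsetIr _ _); apply: indepS iB0 (subsetIl _ _).
have sDS : B0 :\: C \subset S.
  by apply/subsetP => x /setDP[/(subsetP sB0)/setUP[//|xC] /negP[]].
have eqS : B0 :\: C = S.
  by apply/eqP; rewrite eqEcard sDS; move: (cardsID C B0); lia.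
have sSB : S \subset B by rewrite -eqS (subset_trans (subsetDl _ _)).
have sIW : I \subset B :\: S.
  rewrite -eqS; apply/subsetP => x xI; rewrite !inE (subsetP sI) //=.
  by rewrite (subsetP sB) // (subsetP sIB0).
exists (B :\: S); split.
- by rewrite -cB -(cardsID S B) (setIidPr sSB) addnC.
- apply: (rank_absorb sIW); rewrite (setUidPl sI) -cI; exact: indep_le_rank.
- by rewrite -cB -{1}(setIidPr sSB) setID (rank_of_indep iB).
Qed.

(* Ranges over all [C] so that the property passes to contractions. *)
Definition noncrossing_by (T : finType) (M : matroid T) (pos : T -> nat) : Prop :=
  forall (C : {set T}) (a b c p q : T),
  let d := rank_of M C in
  [set a; b; c; p; q] :|: C \subset ground M ->
  rank_of M ([set a; b] :|: C) = 2 + d ->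
  rank_of M ([set a; c] :|: C) = 2 + d ->
  rank_of M ([set b; c] :|: C) = 2 + d ->
  rank_of M ([set a; b; c] :|: C) = 2 + d ->
  rank_of M ([set a; b; p] :|: C) = 3 + d ->
  rank_of M ([set a; b; q] :|: C) = 3 + d ->
  rank_of M ([set a; b; p; q] :|: C) = 3 + d ->
  between (pos a) (pos p) (pos q) = between (pos b) (pos p) (pos q) /\
  between (pos a) (pos p) (pos q) = between (pos c) (pos p) (pos q).

(** By [indep_coextend] for [[set a; b; p]], the contraction of [C] is replaced by that of
    independent columns [W], leaving three free columns; the hypotheses of [bracket_between] are
    then rank computations. *)
Lemma column_noncrossing (R : realFieldType) (k n : nat) (A : 'M[R]_(k, n)) :
  \rank A = k ->
  (forall f : 'I_k -> 'I_n, (forall i j : 'I_k, i < j -> f i < f j) ->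
     (0 <= \det (colsub f A))%R) ->
  noncrossing_by (column_matroid A) (@nat_of_ord n).
Proof.
move=> rankA Apos C a b c p q d _ rab rac rbc rabc rabp rabq rabpq.
set M := column_matroid A in d rab rac rbc rabc rabp rabq rabpq.
have cS : #|[set a; b; p]| = 3.
  apply/eqP; rewrite eqn_leq; apply/andP; split.
    by apply: leq_trans (leq_card_setU _ _) _; rewrite cards1 cards2; case: (a != b).
  have := rank_ofU M [set a; b; p] C; rewrite rabp -/d; lia.
have rS : rank_of M ([set a; b; p] :|: C) = #|[set a; b; p]| + rank_of M C by rewrite cS.
have [W [cW rCW rSW]] := indep_coextend rS.
have rT : rank_of M setT = k by apply: column_matroid_rank.
rewrite rT cS in cW rSW.
have [m [w [cm wW]]] : exists m, exists w : 'I_m -> 'I_n, #|W| = m /\ w @: [set: 'I_m] = W.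
  exists #|W|, enum_val; split=> //; apply/setP => x; apply/imsetP/idP => [[i _ ->]|xW].
    exact: enum_valP.
  by exists (enum_rank_in xW x); rewrite ?inE ?enum_rankK_in.
have kE : k = 3 + m by lia.
clear cW; subst d M k.
set M := column_matroid A in rab rac rbc rabc rabp rabq rabpq cS rS rCW rSW rT *.
(* The elements of [C] lie in the span of [W] and may be added freely. *)
have rC X : rank_of M (X :|: W) = rank_of M (X :|: (C :|: W)).
  by rewrite setUCA (rank_absorb (subsetUr X W)) // rCW.
have full x y z : 3 + m <= rank_of M ([set x; y; z] :|: (C :|: W)) ->
    (bracket w A x y z != 0)%R.
  rewrite -rC => h; rewrite bracket_neq0 wW eqn_leq h andbT.
  exact: column_rank_le.
have absorb (X Y : {set 'I_n}) v : X \subset Y ->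
    rank_of M (v |: (X :|: C)) <= rank_of M (X :|: C) ->
    rank_of M (v |: Y :|: (C :|: W)) = rank_of M (Y :|: (C :|: W)).
  by move=> sXY h; rewrite -setUA (@rank_absorb _ _ (X :|: C)) // setUA subsetU // setSU.
(* An element in the span of [X :|: C] may be dropped from a spanning set; all nonzero brackets
   follow in this way from that of [a], [b], [p]. *)
have chain v (X Y Y' : {set 'I_n}) : X \subset Y -> Y' \subset v |: Y ->
    rank_of M (v |: (X :|: C)) <= rank_of M (X :|: C) ->
    3 + m <= rank_of M (Y' :|: (C :|: W)) -> 3 + m <= rank_of M (Y :|: (C :|: W)).
  by move=> sXY sY' h /leq_trans; apply; rewrite -(absorb _ _ _ sXY h) rank_ofS ?setSU.
have ca X : 3 + m <= rank_of M ([set a; b; X] :|: (C :|: W)) ->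
    3 + m <= rank_of M ([set a; c; X] :|: (C :|: W)).
  apply: (@chain b [set a; c]); [by sub_solve | by sub_solve |].
  rewrite rac -rabc rank_ofS //; by sub_solve.
have cb X : 3 + m <= rank_of M ([set a; b; X] :|: (C :|: W)) ->
    3 + m <= rank_of M ([set b; c; X] :|: (C :|: W)).
  apply: (@chain a [set b; c]); [by sub_solve | by sub_solve |].
  rewrite rbc -rabc rank_ofS //; by sub_solve.
have fabp : 3 + m <= rank_of M ([set a; b; p] :|: (C :|: W)) by rewrite -rC rSW.
have fabq : 3 + m <= rank_of M ([set a; b; q] :|: (C :|: W)).
  apply: (@chain p [set a; b; q] _ _ _ _ _ fabp) => //; first by sub_solve.
  rewrite rabq -rabpq rank_ofS //; by sub_solve.
apply: (@bracket_between _ _ _ A w Apos); try by apply: full; auto.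
(* Otherwise [a], [b] and [W] alone would have rank [3 + m], since [c] is spanned by [a], [b] and
   [C]; but these are at most [2 + m] elements. *)
apply/eqP/negPn; rewrite bracket_neq0 wW rC; apply/negP => /eqP rk.
have : rank_of M (c |: [set a; b] :|: (C :|: W)) = 3 + m.
  rewrite -rk; congr (rank_of M _); by set_solve.
rewrite (absorb [set a; b]) //; last by rewrite rab -rabc rank_ofS //; sub_solve.
rewrite -rC => rk2.
have := rank_ofU M [set a; b] W; rewrite rk2.
have := rank_of_card M W; rewrite cm cards2; case: (a != b); lia.
Qed.

Section Isomorphism.
Variables (T1 T2 : finType) (M1 : matroid T1) (M2 : matroid T2).

(** A map between the ambient types in place of the bijection of subtypes in [matroid_iso]; its
    values off the ground set are arbitrary. *)
Definition iso_by (g : T1 -> T2) : Prop :=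
  [/\ {in ground M1 &, injective g}, g @: ground M1 = ground M2 &
      forall X : {set T1}, X \subset ground M1 -> (X \in indep M1) = (g @: X \in indep M2)].

Lemma iso_byP x0 : x0 \in ground M1 -> matroid_iso M1 M2 -> exists g, iso_by g.
Proof.
move=> x0E [f [bijf indf]].
pose g x := val (f (insubd (exist _ x0 x0E) x)).
have gE (u : {x : T1 | x \in ground M1}) : g (val u) = val (f u) by rewrite /g valKd.
have valE (X : {set T1}) : X \subset ground M1 ->
    exists X' : {set {x : T1 | x \in ground M1}}, X = val @: X'.
  move=> sX; exists [set u | val u \in X]; apply/setP => x.
  apply/idP/imsetP => [xX|[u]]; last by rewrite inE => uX ->.
  by exists (exist _ x (subsetP sX _ xX)); rewrite ?inE.
have imE (X' : {set {x : T1 | x \in ground M1}}) : g @: (val @: X') = val @: (f @: X').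
  by rewrite -!imset_comp; apply: eq_imset => u /=; rewrite gE.
exists g; split.
- move=> x y xE yE; rewrite -[x]/(val (exist (fun x => x \in ground M1) x xE)).
  rewrite -[y]/(val (exist (fun x => x \in ground M1) y yE)) !gE.
  by move/val_inj/(bij_inj bijf)->.
- apply/setP => y; apply/imsetP/idP => [[x xE ->]|yE].
    by rewrite -[x]/(val (exist (fun x => x \in ground M1) x xE)) gE; apply: valP.
  have [f' fK f'K] := bijf; exists (val (f' (exist _ y yE))); first exact: valP.
  by rewrite gE f'K.
- by move=> X /valE[X' ->]; rewrite indf imE.
Qed.

Lemma iso_by_iso g : iso_by g -> matroid_iso M1 M2.
Proof.
case=> injg img indg.
have gE (u : {x : T1 | x \in ground M1}) : g (val u) \in ground M2.
  by rewrite -img imset_f //; apply: valP.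
pose f u : {x : T2 | x \in ground M2} := exist _ (g (val u)) (gE u).
exists f; split.
  apply: inj_card_bij.
    by move=> u v /(congr1 val)/= /(injg _ _ (valP u) (valP v))/val_inj.
  by rewrite !card_sig -img card_in_imset.
move=> X; have -> : val @: (f @: X) = g @: (val @: X) by rewrite -!imset_comp; apply: eq_imset.
rewrite indg //.
by apply/subsetP => x /imsetP[u _ ->]; apply: valP.
Qed.

Lemma iso_rank g (X : {set T1}) : iso_by g -> X \subset ground M1 ->
  rank_of M1 X = rank_of M2 (g @: X).
Proof.
case=> injg img indg sX.
have injX (Y : {set T1}) : Y \subset ground M1 -> #|g @: Y| = #|Y|.
  by move=> sY; rewrite card_in_imset //; apply: sub_in2 injg; apply/subsetP.
apply/eqP; rewrite eqn_leq; apply/andP; split; apply: rank_of_le => I iI sI.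
  have sIE := subset_trans sI sX.
  by rewrite -injX //; apply: indep_le_rank; rewrite -?indg // imsetS.
have eI : I = g @: (X :&: g @^-1: I).
  apply/setP => y; apply/idP/imsetP => [yI|[x]]; last by rewrite !inE => /andP[_ xI] ->.
  by have /imsetP[x xX e] := subsetP sI y yI; exists x; rewrite // !inE xX -e.
have sIE : X :&: g @^-1: I \subset ground M1 by apply: subset_trans (subsetIl _ _) sX.
by rewrite eI injX //; apply: indep_le_rank (subsetIl _ _); rewrite indg // -eI.
Qed.

End Isomorphism.

Definition noncrossing (T : finType) (M : matroid T) : Prop :=
  exists2 pos : T -> nat, {in ground M &, injective pos} & noncrossing_by M pos.

Lemma positroid_noncrossing (R : realType) (T : finType) (M : matroid T) :
  positroid R M -> noncrossing M.
Proof.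
move=> [k [n [A [rankA Apos isoM]]]].
(* [iso_byP] needs an element as default value, so the empty ground set is treated apart. *)
have [E0|[x0 x0E]] := set_0Vmem (ground M).
  exists (fun=> 0); first by move=> x y; rewrite E0 inE.
  by move=> C a b c p q d; rewrite E0 !subUset !sub1set inE.
have [g isog] := iso_byP x0E isoM; have [injg img _] := isog.
exists (fun x => nat_of_ord (g x)); first by move=> x y xE yE /val_inj/injg->.
move=> C a b c p q d sE.
have sub (X : {set T}) : X \subset [set a; b; c; p; q] :|: C -> X \subset ground M.
  by move/subset_trans; apply.
rewrite /d !(iso_rank isog); do 1?[apply: sub; by sub_solve].
rewrite !imsetU !imset_set1.
by apply: (column_noncrossing rankA Apos); rewrite subsetT.
Qed.

(** * Passage to minors *)

Section MinorClosed.
Variable T : finType.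
Implicit Types (M N : matroid T) (C D X : {set T}).

Lemma rank_of_delete_sub M D X : X \subset ground (delete M D) ->
  rank_of (delete M D) X = rank_of M X.
Proof.
by rewrite /= subsetD rank_of_delete => /andP[_ dX]; rewrite (setDidPl dX).
Qed.

Lemma noncrossing_delete M D : noncrossing M -> noncrossing (delete M D).
Proof.
case=> pos inj nc; exists pos.
  by apply: sub_in2 inj => x /setDP[].
move=> C a b c p q d sE.
have sub (X : {set T}) : X \subset [set a; b; c; p; q] :|: C -> X \subset ground (delete M D).
  by move/subset_trans; apply.
rewrite /d !rank_of_delete_sub; do 1?[apply: sub; by sub_solve].
by apply: nc; apply: subset_trans sE _; apply: subsetDl.
Qed.

Lemma noncrossing_contract M D : D \subset ground M ->
  noncrossing M -> noncrossing (contract M D).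
Proof.
move=> sD [pos inj nc]; exists pos.
  by apply: sub_in2 inj => x /setDP[].
move=> C a b c p q d sE r1 r2 r3 r4 r5 r6 r7.
have rE X e : rank_of (contract M D) (X :|: C) = e + d ->
    rank_of M (X :|: (C :|: D)) = e + rank_of M (C :|: D).
  by rewrite setUA -!rank_of_contract => ->; rewrite addnA.
apply: (nc (C :|: D)); do 1?[exact: rE].
rewrite setUA subUset sD andbT; apply: subset_trans sE _; apply: subsetDl.
Qed.

(** What the inductions need of the given positroid; in place of a representation it keeps
    [noncrossing], which passes to deletions and contractions by rank computations. *)
Definition admissible l M : Prop :=
  [/\ simple_matroid M, noncrossing M & ~ has_minor M (uniform 2 (l + 2))].

Lemma no_minor_trans l M N : minor M N ->
  ~ has_minor M (uniform 2 (l + 2)) -> ~ has_minor N (uniform 2 (l + 2)).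
Proof. by move=> mN nM [P mP iso]; case: nM; exists P => //; apply: minor_trans mP. Qed.

Lemma simple_delete M D : simple_matroid M -> simple_matroid (delete M D).
Proof.
move=> /simpleP[h1 h2]; apply/simpleP; split=> [x xE|x y xE yE ne].
  by rewrite rank_of_delete_sub ?sub1set // h1 //; case/setDP: xE.
rewrite rank_of_delete_sub ?subUset ?sub1set ?xE // h2 //.
  by case/setDP: xE.
by case/setDP: yE.
Qed.

Lemma admissible_delete l M D : admissible l M -> admissible l (delete M D).
Proof.
case=> sM ncM nm; split; [exact: simple_delete|exact: noncrossing_delete|].
by apply: no_minor_trans nm; apply: minor_delete; apply: minor_refl.
Qed.

Lemma admissible_contract l M C D : C \subset ground M -> admissible l M ->
  simple_matroid (delete (contract M C) D) -> admissible l (delete (contract M C) D).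
Proof.
move=> sC [_ ncM nm] sN; split=> //.
  exact/noncrossing_delete/noncrossing_contract.
by apply: no_minor_trans nm; do 2 constructor; apply: minor_refl.
Qed.

(** In a simple matroid of rank at most two the independent sets are those with at most two
    elements, so any enumeration is an isomorphism; [0 < n] supplies its default element. *)
Lemma iso_uniform2 M n : 0 < n -> simple_matroid M -> rank_of M (ground M) <= 2 ->
  #|ground M| = n -> matroid_iso M (uniform 2 n).
Proof.
move=> n_gt0 /simpleP[h1 h2] rM cM.
have indE X : X \subset ground M -> (X \in indep M) = (#|X| <= 2).
  move=> sX; apply/idP/idP => [/rank_of_indep<-|].
    by apply: leq_trans rM; apply: rank_ofS.
  rewrite leq_eqVlt => /orP[/cards2P[x [y [ne eX]]]|].
    move: sX; rewrite eX subUset !sub1set => /andP[xE yE].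
    by rewrite indep_rank_of h2 // cards2 ne.
  rewrite ltnS leq_eqVlt => /orP[/cards1P[x eX]|].
    by move: sX; rewrite eX sub1set => xE; rewrite indep_rank_of h1 // cards1.
  by rewrite ltnS leqn0 cards_eq0 => /eqP->; apply: indep0.
case: n n_gt0 cM => // n _ cM.
have [x0 x0E] : exists x0, x0 \in ground M.
  by apply/set0Pn; rewrite -cards_eq0 cM.
pose g x : 'I_n.+1 := cast_ord cM (enum_rank_in x0E x).
have injg : {in ground M &, injective g}.
  by move=> x y xE yE /cast_ord_inj/(congr1 enum_val); rewrite !enum_rankK_in.
apply: (@iso_by_iso _ _ _ _ g); split=> //.
  by apply/eqP; rewrite eqEcard subsetT card_in_imset // cM cardsT card_ord /=.
move=> X sX; rewrite indE // inE card_in_imset //.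
by apply: sub_in2 injg; apply/subsetP.
Qed.

End MinorClosed.

(** * The bound *)

Section Lines.
Variables (T : finType) (M : matroid T).
Implicit Types (X Y L : {set T}) (x y z : T).
Hypothesis simpleM : simple_matroid M.
Local Notation r := (rank_of M).
Local Notation E := (ground M).

Lemma simple_rank1 x : x \in E -> r [set x] = 1.
Proof. by case/simpleP: simpleM => h _; apply: h. Qed.

Lemma simple_rank2 x y : x \in E -> y \in E -> x != y -> r [set x; y] = 2.
Proof. by case/simpleP: simpleM => _ h; apply: h. Qed.

Lemma rank_line x y X : x \in E -> y \in E -> x != y ->
  (forall z, z \in X -> r [set x; y; z] <= 2) -> r (X :|: [set x; y]) = 2.
Proof.
move=> xE yE ne h; rewrite rank_absorb_all ?simple_rank2 // => z /h.
by rewrite setUC.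
Qed.

(** Restriction to [l + 2] points of a longer line would give the excluded minor. *)
Lemma line_bound l X : ~ has_minor M (uniform 2 (l + 2)) ->
  X \subset E -> r X <= 2 -> #|X| <= l + 1.
Proof.
move=> nm sX rX; rewrite leqNgt; apply/negP => cX; apply: nm.
pose Y := [set x in take (l + 2) (enum X)].
have sYX : Y \subset X.
  by apply/subsetP => x; rewrite inE => /mem_take; rewrite mem_enum.
have sY := subset_trans sYX sX.
have cY : #|Y| = l + 2.
  rewrite cardsE (card_uniqP _) ?take_uniq ?enum_uniq // size_takel // -cardE; lia.
have gN : ground (delete M (~: Y)) = Y by rewrite /= setDE setCK (setIidPr sY).
exists (delete M (~: Y)); first exact/minor_delete/minor_refl.
apply: iso_uniform2; [lia | exact: simple_delete | | by rewrite gN].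
by rewrite rank_of_delete_sub // gN; apply: leq_trans rX; apply: rank_ofS.
Qed.

Section Noncrossing.
Variable pos : T -> nat.
Hypothesis pos_inj : {in E &, injective pos}.
Hypothesis pos_nc : noncrossing_by M pos.

Lemma noncrossing_line a b c p q :
  a \in E -> b \in E -> c \in E -> p \in E -> q \in E ->
  a != b -> a != c -> b != c -> r [set a; b; c] <= 2 ->
  2 < r [set a; b; p] -> 2 < r [set a; b; q] -> r [set a; b; p; q] <= 3 ->
  between (pos a) (pos p) (pos q) = between (pos b) (pos p) (pos q) /\
  between (pos a) (pos p) (pos q) = between (pos c) (pos p) (pos q).
Proof.
move=> aE bE cE pE qE ab ac bc rabc rabp rabq rabpq.
have mono x : r [set a; b] <= r [set a; b; x] by apply: rank_ofS; sub_solve.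
have mono3 x : r [set a; b; x] <= (r [set a; b]).+1.
  by rewrite setUC; apply: rank_ofU1.
have rab : r [set a; b] = 2 by apply: simple_rank2.
have : r [set a; b; p] <= r [set a; b; p; q] by apply: rank_ofS; sub_solve.
move: (mono c) (mono3 p) (mono3 q); rewrite rab => m1 m2 m3 m4.
apply: (pos_nc (C := set0)); rewrite ?setU0 ?rank_of0 ?simple_rank2 //; try lia.
by rewrite !subUset !sub1set aE bE cE pE.
Qed.

(* [e] is the middle point of a collinear triple [a < e < c] of minimal span:
   a second long line through [e] would have to fit inside the same span. *)
Lemma exists_good_element : 2 <= r E -> exists e b, [/\ e \in E, b \in E, e != b &
  forall x y, x \in E -> y \in E -> x != e -> y != e -> x != y ->
    r [set e; x; y] <= 2 -> r [set e; b; x] <= 2].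
Proof.
move=> rE.
pose P (t : T * T * T) := let: (u, v, w) := t in
  [&& u \in E, v \in E, w \in E, pos u < pos v, pos v < pos w & r [set u; v; w] <= 2].
(* A collinear triple can be sorted without leaving its range of positions. *)
have sortP u v w : u \in E -> v \in E -> w \in E -> u != v -> u != w -> v != w ->
    r [set u; v; w] <= 2 -> exists u' v' w', [/\ P (u', v', w'),
      minn (pos u) (minn (pos v) (pos w)) <= pos u' &
      pos w' <= maxn (pos u) (maxn (pos v) (pos w))].
  move=> uE vE wE uv uw vw rk.
  have ne x y : x \in E -> y \in E -> x != y -> pos x != pos y.
    by move=> xE yE; apply: contraNneq => /pos_inj->.
  have n1 := ne _ _ uE vE uv; have n2 := ne _ _ uE wE uw; have n3 := ne _ _ vE wE vw.
  have go x y z : [set x; y; z] = [set u; v; w] -> x \in E -> y \in E -> z \in E ->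
     pos x < pos y -> pos y < pos z -> P (x, y, z).
    by move=> e xE yE zE h1 h2; rewrite /P xE yE zE h1 h2 e rk.
  case: (ltngtP (pos u) (pos v)) n1 => // h1 _;
  case: (ltngtP (pos u) (pos w)) n2 => // h2 _;
  case: (ltngtP (pos v) (pos w)) n3 => // h3 _; try (exfalso; lia).
  - by exists u, v, w; split; [apply: go | lia | lia].
  - by exists u, w, v; split; [apply: go => //; set_solve | lia | lia].
  - by exists w, u, v; split; [apply: go => //; set_solve | lia | lia].
  - by exists v, u, w; split; [apply: go => //; set_solve | lia | lia].
  - by exists v, w, u; split; [apply: go => //; set_solve | lia | lia].
  - by exists w, v, u; split; [apply: go => //; set_solve | lia | lia].
(* Without collinear triples every pair of elements satisfies the condition vacuously. *)
case: (pickP P) => [t0 Pt0|none]; last first.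
  have : 1 < #|E| by apply: leq_trans rE (rank_of_card _ _).
  case/card_gt1P=> e [b [eE bE ne]]; exists e, b; split=> // x y xE yE xe ye xy rk.
  rewrite eq_sym in xe; rewrite eq_sym in ye.
  by have [u [v [w []]]] := sortP e x y eE xE yE xe ye xy rk; rewrite none.
pose span (t : T * T * T) := pos t.2 - pos t.1.1.
case: (arg_minnP span Pt0) => -[[a e] c] /and5P[aE eE cE ae /andP[ec rk]] min.
have ne x y : pos x < pos y -> x != y by apply: contraTneq => ->; rewrite ltnn.
exists e, a; split=> //; first by rewrite eq_sym ne.
move=> x y xE yE xe ye xy rexy; rewrite leqNgt; apply/negP => reax.
(* Two distinct lines through [e] meet only there, so no other point of the line of [a] and [e] is
   on that of [x] and [e]. *)
have off z : z \in E -> z != e -> r [set a; e; z] <= 2 -> 2 < r [set x; e; z].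
  move=> zE ze rz; rewrite ltnNge; apply/negP => rxz.
  have := @rank_line e z [set a; x] eE zE _ _; rewrite eq_sym => /(_ ze) rr.
  move: reax; rewrite ltnNge => /negP; apply.
  rewrite -(rr _); first by apply: rank_ofS; sub_solve.
  move=> t /set2P[]->; [move: rz|move: rxz]; apply: leq_trans; rewrite rank_ofS //; sub_solve.
have ea : e != a by rewrite eq_sym ne.
have ce : c != e by rewrite eq_sym ne.
have rxea : 2 < r [set x; e; a].
  by apply: off => //; rewrite ?(eq_sym a) //; apply: leq_trans rk; apply: rank_ofS; sub_solve.
have [] := @noncrossing_line x e y a c xE eE yE aE cE xe xy _ _ rxea _ _.
- by rewrite eq_sym.
- by apply: leq_trans rexy; apply: rank_ofS; sub_solve.
- exact: off.
- apply: leq_trans (leq_trans (rank_ofU1 M x [set a; e; c]) _); last by rewrite ltnS.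
  by apply: rank_ofS; sub_solve.
rewrite eq_sym in xe; rewrite eq_sym in ye.
(* As [e] lies between [a] and [c], so do [x] and [y]; sorting [e], [x], [y] gives a triple of
   smaller span. *)
have [u [v [w [Puvw lo hi]]]] := sortP e x y eE xE yE xe ye xy rexy.
move: (min _ Puvw) ae ec lo hi; rewrite /span /= /between; clear; lia.
Qed.

End Noncrossing.
End Lines.

Section Bound.
Variables (T : finType) (l : nat).
Implicit Types (M N : matroid T) (X Y L : {set T}) (x y z : T).

(** [N] is the simplification of the contraction of a good element [e]. Only the line [L] through
    [e] can have more than two points, and contraction turns it into a parallel class, represented
    by [b]. The last clause holds because [e] and [b] span [L]. *)
Lemma reduction M : admissible l M -> 2 <= matroid_rank M ->
  exists b L N, [/\ admissible l N, [/\ L \subset ground M, b \in L, rank_of M L <= 2,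
     0 < #|L| & #|L| <= l + 1],
     ground N = ground M :\: (L :\ b) &
     forall X, b \in X -> X \subset ground N -> rank_of M (X :|: L) = (rank_of N X).+1].
Proof.
move=> adM rM; have [sM [pos pos_inj pos_nc] nm] := adM.
have [e [b [eE bE ne good]]] := exists_good_element sM pos_inj pos_nc rM.
pose L := matroid_closure M [set e; b].
have seb : [set e; b] \subset ground M by rewrite subUset !sub1set eE.
have sebL : [set e; b] \subset L by apply: sub_closure.
have [eL bL] : e \in L /\ b \in L.
  by move: sebL; rewrite subUset !sub1set => /andP[].
have sL : L \subset ground M by apply/subsetP => x /setIdP[].
have rL : rank_of M L = 2.
  by rewrite -(setUidPl sebL) rank_closure simple_rank2.
have inL x : x \in ground M -> rank_of M [set e; b; x] <= 2 -> x \in L.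
  move=> xE h; rewrite inE xE /= setUC eqn_leq.
  by rewrite [X in _ && X]rank_ofS ?subsetUl // andbT simple_rank2.
have clL : rank_of M (L :|: [set e; b]) = rank_of M [set e; b] by apply: rank_closure.
move: L sebL eL bL sL rL inL clL => L sebL eL bL sL rL inL clL.
pose N := delete (contract M [set e]) (L :\ b).
have gN : ground N = ground M :\: (L :\ b).
  apply/setP => x; rewrite /= !inE.
  by case: (eqVneq x e) => [->|//] /=; rewrite eL ne !andbF.
have rN X : X \subset ground N -> rank_of M (e |: X) = (rank_of N X).+1.
  move=> sX; rewrite rank_of_delete_sub // -addn1 -(simple_rank1 sM eE).
  by rewrite rank_of_contract setUC.
have gNP x : x \in ground N -> [/\ x \in ground M, e != x & (x \in L -> x = b)].
  rewrite gN !inE negb_and negbK => /andP[h ->]; split=> //.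
    by apply/eqP => ex; move: h; rewrite -ex eL (negbTE ne).
  by move=> xL; move: h; rewrite xL orbF => /eqP.
have sN : simple_matroid N.
  apply/simpleP; split=> [x xN|x y xN yN xy].
    have [xE xe _] := gNP x xN.
    have := rN [set x]; rewrite sub1set => /(_ xN).
    by rewrite (simple_rank2 sM eE xE xe) => -[].
  have [xE xe xL] := gNP x xN; have [yE ye yL] := gNP y yN.
  have := rN [set x; y]; rewrite subUset !sub1set xN => /(_ yN) rk.
  have le2 := rank_of2 N x y; apply/eqP; rewrite eqn_leq le2 -ltnS -rk ltnNge.
  (* Elements parallel in the contraction are collinear with [e], hence on [L] by the choice of [e],
     hence both equal to [b]. *)
  apply/negP => col3; rewrite setUA in col3.
  have eb : x = b.
    by apply/xL/inL => //; apply: (good x y) => //; rewrite eq_sym.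
  have : y = b.
    apply/yL/inL => //; apply: (good y x); rewrite // 1?eq_sym //.
    by apply: leq_trans col3; apply: rank_ofS; sub_solve.
  by move=> yb; rewrite eb yb eqxx in xy.
exists b, L, N; split=> //.
- by apply: admissible_contract; rewrite // sub1set.
- split=> //; first by rewrite rL.
    by apply/card_gt0P; exists b.
  by apply: (line_bound sM nm) => //; rewrite rL.
- move=> X bX sX; rewrite -rN //.
  have sub : [set e; b] \subset e |: X by rewrite subUset !sub1set !inE eqxx bX orbT.
  have -> : X :|: L = L :|: (e |: X).
    by apply/setP => x; rewrite !inE; case: (eqVneq x e) => [->|//]; rewrite ?eL ?orbT //= orbC.
  by apply: (rank_absorb sub); rewrite clL.
Qed.

Lemma reduction_ground M L b : L \subset ground M ->
  (ground M :\: (L :\ b)) :|: L = ground M.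
Proof.
move=> sL; apply/setP => x; rewrite !inE.
case: (boolP (x \in L)) => [/(subsetP sL)->|]; first by rewrite orbT.
by rewrite andbF orbF.
Qed.

Lemma reduction_card M L b : L \subset ground M -> b \in L ->
  #|ground M| = #|ground M :\: (L :\ b)| + #|L| - 1.
Proof.
move=> sL bL; have sLb : L :\ b \subset ground M by apply: subset_trans (subD1set _ _) sL.
have := cardsD1 b L; rewrite bL => cL.
by have := cardsID (L :\ b) (ground M); rewrite (setIidPr sLb); lia.
Qed.

(** Induction on the rank: [reduction] removes [#|L| - 1 <= l] elements and one unit of rank. *)
Theorem admissible_card_bound M : admissible l M -> #|ground M| <= l * (matroid_rank M - 1) + 1.
Proof.
have [k leM] := ubnP (matroid_rank M); elim: k M leM => // k IHk M leM adM.
have [sM _ nm] := adM.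
have [r1|r2] := leqP (matroid_rank M) 1.
  (* In rank at most one the bound is 1, and two elements of a simple matroid would have rank
     two. *)
  suff : #|ground M| <= 1 by lia.
  apply/card_le1_eqP => x y xE yE; apply/eqP/negPn/negP => ne.
  have : rank_of M [set y; x] <= matroid_rank M.
    by apply: rank_ofS; rewrite subUset !sub1set xE yE.
  by rewrite (simple_rank2 sM yE xE ne); lia.
have [b [L [N [adN [sL bL rL L0 cL] gN rN]]]] := reduction adM r2.
have bN : b \in ground N by rewrite gN !inE eqxx (subsetP sL).
have rNE : matroid_rank M = (matroid_rank N).+1.
  by rewrite -(rN _ bN (subxx _)) gN reduction_ground.
have rk1 : 0 < matroid_rank N by lia.
have := IHk N _ adN; rewrite rNE in leM => /(_ leM).
rewrite (reduction_card sL bL) -gN rNE.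
have : l * (matroid_rank N).-1.+1 = l * (matroid_rank N).-1 + l by rewrite mulnSr.
rewrite prednK // !subn1 /=; lia.
Qed.

End Bound.

(** The lines of M(K4) are [x y p3], [x z p2], [y z p1] and [p1 p2 p3]. For each of them two of the
    remaining points are tested, and a case analysis shows that no order of the six passes all four
    tests. *)
Lemma no_K4_order (x y z p1 p2 p3 : nat) : uniq [:: x; y; z; p1; p2; p3] ->
  between x z p1 = between y z p1 -> between x z p1 = between p3 z p1 ->
  between x y p1 = between z y p1 -> between x y p1 = between p2 y p1 ->
  between y x p2 = between z x p2 -> between y x p2 = between p1 x p2 ->
  between p1 y z = between p2 y z -> between p1 y z = between p3 y z -> False.
Proof.
rewrite /between /= !inE.
compare_pos y z; compare_pos y p1; compare_pos z p1; compare_pos x y; compare_pos x z;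
compare_pos x p1; compare_pos p2 y; compare_pos p2 z; compare_pos p2 p1; compare_pos p2 x;
compare_pos p3 y; compare_pos p3 z; compare_pos p3 p1.
Qed.

(** * Exclusion of M(K4) *)

Section NoK4.
Variables (T : finType) (M : matroid T).
Hypothesis simpleM : simple_matroid M.
Hypothesis ncM : noncrossing M.
Local Notation r := (rank_of M).
Local Notation E := (ground M).

Lemma line_eq a b c d : a \in E -> b \in E -> a != b ->
  r [set a; b; c] <= 2 -> r [set a; b; d] <= 2 ->
  r [set a; b; c; d] <= 2.
Proof.
move=> aE bE ab h1 h2; have := @rank_line _ M simpleM a b [set c; d] aE bE ab.
move=> /(_ _) <-; first by apply: rank_ofS; sub_solve.
by move=> t /set2P[]->.
Qed.

Lemma rank3_neq a b c : 2 < r [set a; b; c] -> [/\ a != b, a != c & b != c].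
Proof.
have le u v : [set a; b; c] \subset [set u; v] -> r [set a; b; c] <= 2.
  by move=> sub; apply: leq_trans (rank_of2 M u v); apply: rank_ofS.
move=> h; split; apply: contraTneq h => e; rewrite -leqNgt.
- by apply: (le b c); rewrite e; sub_solve.
- by apply: (le b c); rewrite e; sub_solve.
- by apply: (le a c); rewrite e; sub_solve.
Qed.

Lemma no_K4 x y z p1 p2 p3 :
  [/\ x \in E, y \in E & z \in E] -> [/\ p1 \in E, p2 \in E & p3 \in E] ->
  2 < r [set x; y; z] ->
  [/\ r [set x; y; p3] <= 2, p3 != x & p3 != y] ->
  [/\ r [set x; z; p2] <= 2, p2 != x & p2 != z] ->
  [/\ r [set y; z; p1] <= 2, p1 != y & p1 != z] ->
  r [set p1; p2; p3] <= 2 -> False.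
Proof.
move=> [xE yE zE] [p1E p2E p3E] xyz [c3 p3x p3y] [c2 p2x p2z] [c1 p1y p1z] c0.
have [pos pos_inj pos_nc] := ncM.
have [xy xz yz] := rank3_neq xyz.
(* If [d] were on the line of [a], [b], [c], the four points would have rank two, yet they contain a
   triple of rank three. *)
have off a b c : a \in E -> b \in E -> a != b -> r [set a; b; c] <= 2 ->
    forall d u v w, 2 < r [set u; v; w] -> [set u; v; w] \subset [set a; b; c; d] ->
    2 < r [set a; b; d].
  move=> aE bE ab h d u v w uvw sub; rewrite ltnNge; apply/negP => h'.
  by move: uvw; rewrite ltnNge (leq_trans (rank_ofS _ sub)) // line_eq.
have rot a b c : r [set a; b; c] = r [set b; c; a] by congr (r _); set_solve.
have swp a b c : r [set a; b; c] = r [set b; a; c] by congr (r _); set_solve.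
have s132 a b c : r [set a; b; c] = r [set a; c; b] by congr (r _); set_solve.
have xyp1 : 2 < r [set x; y; p1].
  rewrite rot; apply: (off y p1 z _ _ _ _ x x y z) => //;
    rewrite 1?eq_sym //; last by sub_solve.
  by rewrite -rot swp.
have xzp1 : 2 < r [set x; z; p1].
  rewrite rot; apply: (off z p1 y _ _ _ _ x x y z) => //;
    rewrite 1?eq_sym //; last by sub_solve.
  by rewrite -rot.
have yzp2 : 2 < r [set y; z; p2].
  rewrite rot; apply: (off z p2 x _ _ _ _ y x y z) => //;
    rewrite 1?eq_sym //; last by sub_solve.
  by rewrite -rot.
have p12z : 2 < r [set p1; p2; z].
  rewrite -rot; apply: (off z p1 y _ _ _ _ p2 y z p2) => //;
    rewrite 1?eq_sym //; last by sub_solve.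
  by rewrite -rot.
have p12y : 2 < r [set p1; p2; y].
  rewrite -rot; apply: (off y p1 z _ _ _ _ p2 y z p2) => //;
    rewrite 1?eq_sym //; last by sub_solve.
  by rewrite -rot swp.
have p12 : p1 != p2 by have [] := rank3_neq p12z.
have p3z : p3 != z by apply: contraTneq xyz => <-; rewrite -leqNgt.
have p2y : p2 != y by have [_ /negbTE] := rank3_neq yzp2; rewrite eq_sym => ->.
have p1x : p1 != x by have [_] := rank3_neq xyp1; rewrite eq_sym.
have p23 : p2 != p3.
  apply: contraTneq xyz => e; rewrite -leqNgt.
  have := @line_eq x p3 y z xE p3E; rewrite eq_sym => /(_ p3x) h.
  apply: leq_trans (h _ _); [by apply: rank_ofS; sub_solve | by rewrite s132 |].
  by rewrite -e s132.
have p13 : p1 != p3.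
  apply: contraTneq xyz => e; rewrite -leqNgt.
  have := @line_eq y p3 x z yE p3E; rewrite eq_sym => /(_ p3y) h.
  apply: leq_trans (h _ _); [by apply: rank_ofS; sub_solve | by rewrite -rot |].
  by rewrite -e s132.
have le3 : r [set x; y; z; p1; p2; p3] <= 3.
  have le : r [set x; y; z] <= 3.
    by rewrite setUC; have := rank_ofU1 M z [set x; y]; rewrite simple_rank2.
  apply: leq_trans le.
  have -> : [set x; y; z; p1; p2; p3] = [set p1; p2; p3] :|: [set x; y; z] by set_solve.
  have absorb a b p : a \in E -> b \in E -> a != b -> r [set a; b; p] <= 2 ->
      [set a; b] \subset [set x; y; z] -> r (p |: [set x; y; z]) <= r [set x; y; z].
    by move=> aE bE ab h sub; rewrite (rank_absorb sub) // simple_rank2 // setUC.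
  rewrite rank_absorb_all // => t; rewrite !inE => /orP[/orP[]|] /eqP->.
  - by apply: (absorb y z) => //; sub_solve.
  - by apply: (absorb x z) => //; sub_solve.
  - by apply: (absorb x y) => //; sub_solve.
have pl (X : {set T}) : X \subset [set x; y; z; p1; p2; p3] -> r X <= 3.
  by move=> sX; apply: leq_trans le3; apply: rank_ofS.
have nc a b c p q :=
  noncrossing_line simpleM pos_nc (a := a) (b := b) (c := c) (p := p) (q := q).
have [] := nc x y p3 z p1 xE yE p3E zE p1E xy; rewrite 1?(eq_sym _ p3) //.
  by apply: pl; sub_solve.
have [] := nc x z p2 y p1 xE zE p2E yE p1E xz; rewrite 1?(eq_sym _ p2) //.
- by rewrite -rot swp.
- by apply: pl; sub_solve.
have [] := nc y z p1 x p2 yE zE p1E xE p2E yz; rewrite 1?(eq_sym _ p1) //.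
- by rewrite -rot.
- by apply: pl; sub_solve.
have [] := nc p1 p2 p3 y z p1E p2E p3E yE zE p12 p13 p23 c0 p12y p12z.
  by apply: pl; sub_solve.
move=> h1 h2 h3 h4 h5 h6 h7 h8.
have ne a b : a \in E -> b \in E -> a != b -> pos a != pos b.
  by move=> aE bE; apply: contraNneq => /pos_inj->.
apply: (@no_K4_order (pos x) (pos y) (pos z) (pos p1) (pos p2) (pos p3)) => //.
by rewrite /= !inE !negb_or !ne // eq_sym.
Qed.

End NoK4.

(** * The case of equality *)

Section Restriction.
Variables (T : finType) (M : matroid T).
Implicit Types (X Y F : {set T}).

Definition restrict X : matroid T := delete M (~: X).

Lemma ground_restrict X : X \subset ground M -> ground (restrict X) = X.
Proof. by move=> sX; rewrite /= setDE setCK (setIidPr sX). Qed.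

Lemma rank_restrict X Y : X \subset ground M -> Y \subset X ->
  rank_of (restrict X) Y = rank_of M Y.
Proof. by move=> sX sY; rewrite rank_of_delete_sub // ground_restrict. Qed.

Lemma flat_restrictP X F : X \subset ground M -> F \subset X ->
  reflect (forall x, x \in X -> x \notin F -> rank_of M F < rank_of M (x |: F))
          (flat (restrict X) F).
Proof.
move=> sX sF; have gX := ground_restrict sX.
have rU x : x \in X -> rank_of (restrict X) (x |: F) = rank_of M (x |: F).
  by move=> xX; rewrite rank_restrict // subUset sub1set xX.
apply: (iffP (flatP _ _)) => [[_ h] x xX xF|h].
  by have := h x; rewrite gX rU // rank_restrict // => /(_ xX xF).
by split=> [|x]; rewrite gX // => xX xF; rewrite rU // rank_restrict // h.
Qed.

Lemma admissible_restrict l X : admissible l M -> admissible l (restrict X).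
Proof. exact: admissible_delete. Qed.

Lemma restrict_bound l X : admissible l M -> X \subset ground M ->
  #|X| <= l * (rank_of M X - 1) + 1.
Proof.
move=> adM sX; have := admissible_card_bound (admissible_restrict X adM).
by rewrite /matroid_rank ground_restrict // rank_restrict.
Qed.

End Restriction.

(** * Points outside a large hyperplane *)

Section Leaf.
Variables (T : finType) (M : matroid T) (l : nat).
Implicit Types (X Y F : {set T}).
Local Notation r := (rank_of M).
Local Notation E := (ground M).
Hypothesis adM : admissible l M.
Hypothesis cardM : #|E| = l * (r E - 1) + 1.
Hypothesis rankM : 2 <= r E.
Variable H : {set T}.
Hypothesis sH : H \subset E.
Hypothesis rH : r H < r E.
Hypothesis cH : #|E :\: H| <= l.

Let simpleM : simple_matroid M. Proof. by case: adM. Qed.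

Lemma hyperplane_card : l * (r E - 2) + 1 <= #|H|.
Proof.
have := cardsID H E; rewrite (setIidPr sH) cardM.
have : l * (r E - 2).+1 = l * (r E - 2) + l by rewrite mulnSr.
have -> : (r E - 2).+1 = r E - 1 by lia.
by lia.
Qed.

(** By [restrict_bound] a set of non-full rank has at most [l * (r E - 2) + 1] elements, and [H] has
    at least as many. *)
Lemma hyperplane_bound X : X \subset E -> r X < r E -> #|X| <= #|H|.
Proof.
move=> sX rX; apply: leq_trans (restrict_bound adM sX) (leq_trans _ hyperplane_card).
by rewrite leq_add2r leq_mul2l; apply/orP; right; lia.
Qed.

(** Otherwise [x |: H] would be a set of non-full rank larger than [H], so [H] is a flat. *)
Lemma outside_hyperplane x : x \in E -> x \notin H -> r H < r (x |: H).
Proof.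
move=> xE xH; rewrite ltnNge; apply/negP => h.
have := @hyperplane_bound (x |: H); rewrite subUset sub1set xE cardsU1 xH add1n ltnn.
by move=> /(_ sH)/(_ (leq_ltn_trans h rH)).
Qed.

Lemma rank_outside_hyperplane x X : x \in E -> x \notin H -> X \subset H ->
  r (x |: X) = (r X).+1.
Proof.
move=> xE xH sX; apply/eqP; rewrite eqn_leq rank_ofU1 ltnNge; apply/negP => h.
by have := outside_hyperplane xE xH; rewrite (rank_absorb sX h) ltnn.
Qed.

(* If the line [xy] avoided [H], then [H :|: [set y]] would survive as a simple
   matroid in the contraction of [x], one element more than the bound allows. *)
Lemma line_meets_hyperplane x y : x \in E :\: H -> y \in E :\: H -> x != y ->
  exists2 h, h \in H & r [set x; y; h] <= 2.
Proof.
move=> /setDP[xE xH] /setDP[yE yH] xy; apply/exists_inP.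
case: (boolP [exists h in H, r [set x; y; h] <= 2]) => //; rewrite negb_exists_in.
move=> /forall_inP miss; exfalso.
have sx : [set x] \subset E by rewrite sub1set.
have xyH : x \notin y |: H by rewrite !inE negb_or xy.
have sY : y |: H \subset E by rewrite subUset sub1set yE.
pose N := delete (contract M [set x]) (~: (y |: H)).
have gN : ground N = y |: H.
  apply/setP => u; rewrite inE in_setC negbK !in_setD in_set1.
  case uYH: (u \in y |: H) => //=; rewrite (subsetP sY) // andbT.
  by apply: contraTneq uYH => ->.
have rN X : X \subset y |: H -> r (x |: X) = (rank_of N X).+1.
  move=> sX; rewrite rank_of_delete_sub ?gN // -addn1 -(simple_rank1 simpleM xE).
  by rewrite rank_of_contract setUC.
have neq u : u \in y |: H -> x != u by apply: contraTneq => <-.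
have sN : simple_matroid N.
  apply/simpleP; split=> [u|u v]; rewrite gN => uN.
    have := rN [set u]; rewrite sub1set => /(_ uN).
    by rewrite (simple_rank2 simpleM xE (subsetP sY _ uN) (neq _ uN)) => -[].
  move=> vN uv; have := rN [set u; v]; rewrite subUset !sub1set uN => /(_ vN) rk.
  apply/eqP; rewrite eqn_leq rank_of2 -ltnS -rk.
  move: uN vN; rewrite !in_setU1 => /orP[/eqP eu|uH] /orP[/eqP ev|vH].
  - by rewrite eu ev eqxx in uv.
  - by rewrite eu setUA ltnNge miss.
  - by rewrite ev (setUC [set u]) setUA ltnNge miss.
  - rewrite (rank_outside_hyperplane xE xH); last by rewrite subUset !sub1set uH.
    by rewrite simple_rank2 // (subsetP sH).
have adN : admissible l N by apply: admissible_contract.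
have := admissible_card_bound adN; rewrite /matroid_rank gN cardsU1 yH.
have := rN _ (subxx _); have : r (x |: (y |: H)) <= r E.
  by apply: rank_ofS; rewrite subUset sx.
have := hyperplane_card; move: (rank_of N _) => rk h1 h2 h3 h4.
have : l * (rk - 1) <= l * (r E - 2) by rewrite leq_mul2l; apply/orP; right; lia.
lia.
Qed.

(** For [x], [y] outside [H], let [p] be a point of [H] on their line. An outside point [z] off this
    line would give points [p1], [p2] of [H] on the other sides of the triangle. The plane of [x],
    [y], [z] meets [H] in rank at most two, so [p1], [p2], [p] are collinear, against [no_K4]. *)
Lemma hyperplane_leaf : exists2 p, p \in H & r (p |: (E :\: H)) <= 2.
Proof.
have [h0 h0H] : exists h0, h0 \in H.
  by apply/card_gt0P; apply: leq_trans hyperplane_card; rewrite addn1.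
have [le1|/card_gt1P[x [y [xS yS xy]]]] := leqP #|E :\: H| 1.
  exists h0 => //; apply: leq_trans (rank_of_card _ _) _.
  by rewrite cardsU1; case: (_ \notin _); lia.
have [p pH colp] := line_meets_hyperplane xS yS xy.
have inE' u : u \in E :\: H -> u \in E by case/setDP.
have ne u h : u \in E :\: H -> h \in H -> h != u.
  by case/setDP=> _ uH hH; apply: contraNneq uH => <-.
exists p => //; have := @rank_line _ M simpleM x y (p |: (E :\: H)) (inE' _ xS) (inE' _ yS) xy.
move=> h; rewrite -h; first exact/rank_ofS/subsetUl.
move=> z; rewrite in_setU1 => /orP[/eqP->//|zS].
rewrite leqNgt; apply/negP => xyz.
have [_ xz yz] := rank3_neq xyz.
have [p2 p2H col2] := line_meets_hyperplane xS zS xz.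
have [p1 p1H col1] := line_meets_hyperplane yS zS yz.
have sHE u : u \in H -> u \in E by apply: (subsetP sH).
have ncM : noncrossing M by case: adM.
have t1 : [/\ x \in E, y \in E & z \in E] by rewrite !inE'.
have t2 : [/\ p1 \in E, p2 \in E & p \in E] by rewrite !sHE.
have l3 : [/\ r [set x; y; p] <= 2, p != x & p != y] by rewrite !ne.
have l2 : [/\ r [set x; z; p2] <= 2, p2 != x & p2 != z] by rewrite !ne.
have l1 : [/\ r [set y; z; p1] <= 2, p1 != y & p1 != z] by rewrite !ne.
apply: (no_K4 simpleM ncM t1 t2 xyz l3 l2 l1).
rewrite leqNgt; apply/negP => p123.
have [p12 p13 p23] := rank3_neq p123.
have sP : [set p1; p2; p] \subset H by rewrite !subUset !sub1set p1H p2H pH.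
have [xE xH] := setDP xS.
(* A fourth dimension would be needed for [x] off the plane of [p1], [p2], [p]. *)
have := rank_outside_hyperplane xE xH sP.
have le3 : r [set x; y; z] <= 3.
  by rewrite setUC; have := rank_ofU1 M z [set x; y]; rewrite simple_rank2 ?inE'.
have absorb a b q : a \in E -> b \in E -> a != b -> r [set a; b; q] <= 2 ->
    [set a; b] \subset [set x; y; z] -> r (q |: [set x; y; z]) <= r [set x; y; z].
  by move=> aE bE ab hh ss; rewrite (rank_absorb ss) // simple_rank2 // setUC.
have : r (x |: [set p1; p2; p]) <= r ([set p1; p2; p] :|: [set x; y; z]).
  by apply: rank_ofS; sub_solve.
rewrite (@rank_absorb_all _ M [set x; y; z]).
  by move=> /leq_trans/(_ le3) h1 h2; move: h1; rewrite h2 ltnS leqNgt p123.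
move=> t; rewrite !inE => /orP[/orP[]|] /eqP->.
- by apply: (absorb y z); rewrite ?inE' //; sub_solve.
- by apply: (absorb x z); rewrite ?inE' //; sub_solve.
- by apply: (absorb x y); rewrite ?inE' //; sub_solve.
Qed.

End Leaf.

(** * Splitting off a line by a parallel connection *)

Section LeafConnection.
Variables (T : finType) (M : matroid T) (H : {set T}) (p : T).
Implicit Types (X Y F : {set T}).
Local Notation r := (rank_of M).
Local Notation E := (ground M).
Local Notation S := (E :\: H).
Local Notation K := (p |: S).
Hypothesis simpleM : simple_matroid M.
Hypothesis sH : H \subset E.
Hypothesis rout : forall s X, s \in S -> X \subset H -> r (s |: X) = (r X).+1.
Hypothesis pH : p \in H.
Hypothesis rK : r K <= 2.

Lemma leaf_sub : K \subset E.
Proof. by rewrite subUset sub1set (subsetP sH) // subsetDl. Qed.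

Lemma flat_restrict X F : X \subset E -> flat M F -> flat (restrict M X) (F :&: X).
Proof.
move=> sX /flatP[sF h]; apply/flat_restrictP; rewrite ?subsetIr // => x xX.
rewrite inE xX andbT => xF; rewrite ltnNge; apply/negP => le.
by have := h x (subsetP sX _ xX) xF; rewrite (rank_absorb (subsetIl F X) le) ltnn.
Qed.

Lemma leaf_parallel_connection :
  is_parallel_connection p (restrict M K) (restrict M H) M.
Proof.
have sK := leaf_sub.
have pE : p \in E by apply: (subsetP sH).
have KH : K :|: H = E.
  by apply/setP => x; rewrite !inE; case: (eqVneq x p) => [->|_] /=;
    rewrite ?pE //; case: (boolP (x \in H)) => [/(subsetP sH)->|]; rewrite ?orbT ?orbF.
split; rewrite !ground_restrict //.
  apply/setP => x; rewrite !inE; case: (eqVneq x p) => [->|_] //=.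
  by case: (x \in H); rewrite ?andbF.
move=> F; rewrite KH.
apply/idP/and3P => [fF|[sF f1 f2]].
  by split; [case/flatP: fF | apply: flat_restrict | apply: flat_restrict].
have fK := flat_restrictP sK (subsetIr _ _) f1.
have fH := flat_restrictP sH (subsetIr _ _) f2.
apply/flatP; split=> // x xE xF; set B := F :&: H in fH.
have sB : B \subset H by apply: subsetIr.
have fH' y : y \in H -> y \notin F -> r B < r (y |: B).
  by move=> yH yF; apply: fH => //; rewrite inE (negbTE yF).
(* If no point of [F] is outside [H], then [F = B]. *)
have [S0|[s /setIP[sF' sS]]] := set_0Vmem (F :&: S).
  have eB : F = B.
    apply/esym/setIidPl/subsetP => y yF; apply/negPn/negP => yH.
    by have := in_set0 y; rewrite -S0 inE yF inE yH (subsetP sF).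
  have [xH|xH] := boolP (x \in H); first by rewrite eB; apply: fH'.
  by rewrite [in X in _ < X]eB rout ?inE ?xH // -eB.
have [sE sH'] := setDP sS.
have sK' : s \in K by rewrite setU1r.
have lift y : y \in H -> y \notin F -> (r B).+1 < r (s |: (y |: B)).
  by move=> yH yF; rewrite rout ?ltnS ?fH' // subUset sub1set yH.
(* If [F] contains the line [K], then [p] is in [B], and [B] together with [s] spans [F]. *)
have [KF|/subsetPn[u uK uF]] := boolP (K \subset F).
  have pF : p \in F by apply: (subsetP KF); rewrite setU11.
  have xH : x \in H.
    by apply: contraR xF => xH; apply: (subsetP KF); rewrite !inE xH xE orbT.
  have sub : [set s; p] \subset s |: B.
    by rewrite subUset !sub1set setU11 setU1r // inE pF.
  have sp : s != p by apply: contraNneq sH' => ->.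
  have rF : r F <= (r B).+1.
    rewrite -(rout sS sB) -(@rank_absorb _ M _ _ K sub).
      apply: rank_ofS; apply/subsetP => y yF; rewrite !inE yF (subsetP sF) //=.
      by case: (y \in H); rewrite ?orbT.
    rewrite simple_rank2 // (leq_trans _ rK) // rank_ofS //.
    by rewrite subUset subxx subUset !sub1set sK' setU11.
  apply: leq_ltn_trans rF (leq_trans (lift x xH xF) _); apply: rank_ofS.
  by rewrite !subUset !sub1set setU11 setU1r // (subset_trans (subsetIl _ _)) // subsetUr.
(* A second point of [F] on [K] would span [K] together with [s], against the flatness of [F :&: K];
   hence [F = s |: B]. *)
have one t : t \in F -> t \in K -> t = s.
  move=> tF tK; apply/eqP/negPn/negP => ts.
  have := fK u uK; rewrite inE (negbTE uF) => /(_ isT); rewrite ltnNge => /negP; apply.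
  apply: leq_trans (leq_trans rK _).
    by apply: rank_ofS; rewrite subUset sub1set uK subsetIr.
  rewrite -(simple_rank2 simpleM (subsetP sK _ tK) sE ts); apply: rank_ofS.
  by rewrite subUset !sub1set !in_setI tF tK sF' sK'.
have pF : p \notin F.
  by apply/negP => /one; rewrite setU11 => /(_ isT) e; rewrite -e pH in sH'.
have eF : F = s |: B.
  apply/setP => y; rewrite in_setU1; apply/idP/orP => [yF|[/eqP->//|/setIP[]//]].
  have [yH|yH] := boolP (y \in H); first by right; rewrite inE yF.
  by left; apply/eqP/one; rewrite // !inE yH (subsetP sF) // orbT.
have rF : r F = (r B).+1 by rewrite eF rout.
rewrite rF; have [xH|xH] := boolP (x \in H).
  by apply: leq_trans (lift x xH xF) _; rewrite eF setUCA.
have xK : x \in K by rewrite !inE xH xE orbT.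
have xs : x != s by apply: contraNneq xF => ->.
(* On the line [K] the points [x] and [s] span [p], so adding [x] to [F] raises the rank at least as
   much as adding [p]. *)
apply: leq_trans (lift p pH pF) _.
have sub : [set x; s] \subset x |: F by rewrite subUset !sub1set setU11 setU1r.
rewrite -(@rank_absorb _ M _ _ [set p] sub).
  apply: rank_ofS; rewrite !subUset !sub1set setU11 !in_setU sF' !orbT /=.
  by rewrite setUA (subset_trans (subsetIl F H)) // subsetUr.
rewrite simple_rank2 // (leq_trans _ rK) // rank_ofS //.
by rewrite !subUset !sub1set xK sK' setU11.
Qed.

End LeafConnection.

Section Extremal.
Variables (T : finType) (l : nat).
Implicit Types (M N : matroid T) (X Y L H : {set T}).

Definition large_hyperplanes M : Prop := forall a, a \in ground M ->
  exists H, [/\ H \subset ground M, a \in H, rank_of M H < matroid_rank M &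
                #|ground M :\: H| <= l].

(* The hyperplanes are carried through the induction because one of the simplified
   contraction [N] is needed in [M]; that it contains the prescribed point [b] allows
   to add the whole contracted line to it. *)
Theorem extremal_structure M n : admissible l M -> matroid_rank M = n.+2 ->
  #|ground M| = l * n.+1 + 1 ->
  large_hyperplanes M /\ parallel_connections_of (uniform 2 (l + 1)) M.
Proof.
elim: n M => [|n IHn] M adM rM cM; have [sM ncM nm] := adM.
  (* In rank two [M] is itself a copy of the uniform matroid, and single points serve as
     hyperplanes. *)
  rewrite muln1 in cM; split.
    move=> a aE; exists [set a]; split; rewrite ?sub1set ?inE //.
      by rewrite rM ltnS rank_of1.
    by have := cardsD1 a (ground M); rewrite aE; lia.
  by apply/PC_copy/iso_uniform2; rewrite // ?addn1 // -/(matroid_rank M) rM.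
have r2 : 2 <= matroid_rank M by rewrite rM.
have cM' : #|ground M| = l * (rank_of M (ground M) - 1) + 1.
  by rewrite -/(matroid_rank M) rM subn1 cM.
have mulE : l * n.+2 = l * n.+1 + l by rewrite mulnSr.
have [b [L [N [adN [sL bL rL L0 cL] gN rN]]]] := reduction adM r2.
have bN : b \in ground N by rewrite gN !inE eqxx (subsetP sL).
have rNE : matroid_rank M = (matroid_rank N).+1.
  by rewrite -(rN _ bN (subxx _)) gN reduction_ground.
have rkN : matroid_rank N = n.+2 by lia.
(* Equality passes to [N]: one inequality is the bound, the other comes from [#|L| <= l + 1]. *)
have cN : #|ground N| = l * n.+1 + 1.
  have := admissible_card_bound adN; rewrite rkN subn1 /=.
  by have := reduction_card sL bL; rewrite -gN cM; lia.
have [hypN _] := IHn N adN rkN cN.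
have [H' [sH' bH' rH' cH']] := hypN b bN.
(* Since [b] is in [H'], adding [L] raises the rank by just one, and no new element is left
   outside. *)
pose H := H' :|: L.
have sH : H \subset ground M.
  by rewrite subUset sL andbT (subset_trans sH') // gN subsetDl.
have rH : rank_of M H < rank_of M (ground M).
  by rewrite rN // -/(matroid_rank M) rNE ltnS.
have cH : #|ground M :\: H| <= l.
  apply: leq_trans cH'; apply: subset_leq_card; apply/subsetP => x.
  by rewrite gN !inE negb_or => /andP[/andP[-> /negbTE->] ->]; rewrite andbF.
have [p pH rK] := hyperplane_leaf adM cM' r2 sH rH cH.
clearbody H; clear H' sH' bH' rH' cH' hypN.
have rout s X : s \in ground M :\: H -> X \subset H -> rank_of M (s |: X) = (rank_of M X).+1.
  by case/setDP=> sE sH'; apply: (rank_outside_hyperplane adM cM' r2 sH rH cH).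
have pE : p \in ground M by apply: (subsetP sH).
set K := p |: (ground M :\: H) in rK.
have sK : K \subset ground M by rewrite /K subUset sub1set pE subsetDl.
have sub1 X : p \in X -> p \in K -> 1 <= rank_of M (X :&: K).
  move=> pX pK; rewrite -(simple_rank1 sM pE); apply: rank_ofS.
  by rewrite sub1set inE pX.
have pK : p \in K by rewrite setU11.
(* [H] and [K] cover the ground set and share [p], so by submodularity [H] loses at most one unit of
   rank. *)
have rHE : rank_of M H = n.+2.
  have := rank_of_submod M H K; have -> : H :|: K = ground M.
    apply/setP => x; rewrite !inE; case: (boolP (x \in H)) => [/(subsetP sH)->//|xH] /=.
    by case: eqP => [->|].
  by have := sub1 H pH pK; rewrite -/(matroid_rank M) in rH *; lia.
have cHE : #|H| = l * n.+1 + 1.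
  have := hyperplane_card cM' r2 sH rH cH; have := restrict_bound adM sH.
  by rewrite rHE -/(matroid_rank M) rM subn1 subn2 /=; lia.
have cS : #|ground M :\: H| = l.
  by have := cardsID H (ground M); rewrite (setIidPr sH); lia.
have cK : #|K| = l + 1 by rewrite cardsU1 inE pH /= cS addnC.
have [hypH pcH] : large_hyperplanes (restrict M H) /\
    parallel_connections_of (uniform 2 (l + 1)) (restrict M H).
  by apply: IHn; rewrite /matroid_rank ?ground_restrict ?rank_restrict //;
    apply: admissible_restrict.
split; last first.
  apply: PC_connect pcH (leaf_parallel_connection sM sH rout pH rK).
  apply/PC_copy/iso_uniform2; rewrite ?addn1 //; first exact: simple_delete.
    by rewrite ground_restrict ?rank_restrict.
  by rewrite ground_restrict // cK addn1.
move=> a aE; have [aH|aH] := boolP (a \in H).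
  by exists H; split.
(* For [a] outside [H], a hyperplane through [p] of the restriction to [H] is enlarged by [K]; as
   both contain [p], the rank grows by at most one. *)
have := hypH p; rewrite ground_restrict // => /(_ pH)[H2 [sH2 pH2 rH2 cH2]].
exists (H2 :|: K); split.
- by rewrite subUset sK (subset_trans sH2).
- by rewrite !inE aH aE !orbT.
- move: rH2; rewrite /matroid_rank !ground_restrict // !rank_restrict //.
  by move: (rank_of_submod M H2 K) (sub1 H2 pH2 pK) rK rH; clear; lia.
- apply: leq_trans cH2; apply: subset_leq_card; apply/subsetP => x.
  by rewrite !inE !negb_or => /andP[/and3P[-> _]]; case: (x \in H) => //= /negPf->.
Qed.

End Extremal.

(** * Ranks of parallel connections *)

Section ParallelConnectionRank.
Variable T : finType.
Implicit Types (M : matroid T) (F X : {set T}).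

Lemma flat_full_rank M F : flat M F -> rank_of M F = matroid_rank M -> F = ground M.
Proof.
move=> fF rF; have [sF h] := flatP M F fF.
apply/eqP; rewrite eqEsubset sF; apply/subsetP => x xE; apply/negPn/negP => /(h x xE).
by rewrite rF ltnNge rank_ofS // subUset sub1set xE.
Qed.

Lemma flat_ground M : flat M (ground M).
Proof. by apply/flatP; split=> // x ->. Qed.

(** Bases [B1] and [B2] through [e] unite to a basis of [M]. The union spans, because its closure
    meets each side in a flat of full rank, and it is independent by [indep_flats]. *)
Lemma parallel_connection_rank e M1 M2 M : is_parallel_connection e M1 M2 M ->
  rank_of M1 [set e] = 1 -> rank_of M2 [set e] = 1 ->
  matroid_rank M + 1 = matroid_rank M1 + matroid_rank M2.
Proof.
move=> [gI gU fM] r1 r2.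
have eI : e \in ground M1 :&: ground M2 by rewrite gI inE.
have [eE1 eE2] := setIP eI.
have basis N : rank_of N [set e] = 1 -> e \in ground N ->
    exists B, [/\ B \in indep N, e \in B, B \subset ground N & #|B| = matroid_rank N].
  move=> rk eN; have ie : [set e] \in indep N by rewrite indep_rank_of rk cards1.
  have := indep_extend ie (X := ground N); rewrite sub1set => /(_ eN)[B [iB eB sB cB]].
  by exists B; split; rewrite // -sub1set.
have [B1 [iB1 eB1 sB1 cB1]] := basis M1 r1 eE1.
have [B2 [iB2 eB2 sB2 cB2]] := basis M2 r2 eE2.
have only x : x \in ground M1 -> x \in ground M2 -> x = e.
  by move=> x1 x2; apply/set1P; rewrite -gI inE x1.
have BI : B1 :&: B2 = [set e].
  apply/setP => x; rewrite !inE; apply/andP/eqP => [[x1 x2]|->//].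
  by apply: only; [apply: (subsetP sB1)|apply: (subsetP sB2)].
have sB : B1 :|: B2 \subset ground M by rewrite gU setUSS.
have cB : #|B1 :|: B2| + 1 = matroid_rank M1 + matroid_rank M2.
  by rewrite -cB1 -cB2 -(cardsUI B1 B2) BI cards1.
suff iB : B1 :|: B2 \in indep M.
  rewrite -cB -(rank_of_indep iB); congr (_ + 1).
  have fC := flat_closure sB; have sC := sub_closure sB.
  move: (fC); rewrite fM => /and3P[_ f1 f2].
  have full (N : matroid T) (B F : {set T}) :
      flat N (F :&: ground N) -> B \subset F -> B \subset ground N ->
      B \in indep N -> #|B| = matroid_rank N -> ground N \subset F.
    move=> fN sBF sBN iBN cBN; rewrite -(@flat_full_rank N (F :&: ground N) fN) ?subsetIl //.
    apply/eqP; rewrite eqn_leq rank_ofS ?subsetIr //= -cBN.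
    by apply: indep_le_rank; rewrite // subsetI sBF.
  have s1 := full M1 B1 _ f1 (subset_trans (subsetUl _ _) sC) sB1 iB1 cB1.
  have s2 := full M2 B2 _ f2 (subset_trans (subsetUr _ _) sC) sB2 iB2 cB2.
  have eC : matroid_closure M (B1 :|: B2) = ground M.
    by apply/eqP; rewrite eqEsubset (proj1 (flatP _ _ fC)) gU subUset s1.
  by rewrite /matroid_rank -eC -(setUidPl sC) rank_closure.
have clN (N : matroid T) (B : {set T}) x :
    B \in indep N -> x \in B -> x \notin matroid_closure N (B :\ x).
  move=> iB xB; rewrite inE setD1K // (rank_of_indep iB) negb_and; apply/orP; right.
  rewrite (rank_of_indep (indepS iB (subD1set B x))) (cardsD1 x B) xB.
  by rewrite add1n neq_ltn ltnSn orbT.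
have sCl N X : matroid_closure N X \subset ground N by apply/subsetP => x /setIdP[].
(* To separate [x] different from [e], the closure of the rest of its own basis is joined with the
   whole other side; this closure still contains [e]. *)
have side (N1 N2 : matroid T) (B1' B2' : {set T}) x :
    B1' \in indep N1 -> B1' \subset ground N1 ->
    B2' \subset ground N2 -> e \in B1' -> x \in B1' -> x != e ->
    (forall y, y \in ground N1 -> y \in ground N2 -> y = e) ->
    e \in ground N2 ->
    let F := matroid_closure N1 (B1' :\ x) :|: ground N2 in
    [/\ flat N1 (F :&: ground N1), F :&: ground N2 = ground N2, (B1' :|: B2') :\ x \subset F,
        x \notin F & F \subset ground N1 :|: ground N2].
  move=> iB sB1' sB2' eB xB xe onl eN2 F.
  have sD : B1' :\ x \subset ground N1 by apply: subset_trans (subD1set _ _) sB1'.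
  have eD : e \in matroid_closure N1 (B1' :\ x).
    by apply: (subsetP (sub_closure sD)); rewrite !inE eq_sym xe.
  split.
  - rewrite setIUl (setIidPl (sCl _ _)) (_ : _ :|: _ = matroid_closure N1 (B1' :\ x)).
      exact: flat_closure.
    apply/setUidPl/subsetP => y /setIP[y2 y1]; by rewrite (onl y).
  - by apply/setIidPr; rewrite subsetUr.
  - apply/subsetP => y /setD1P[yx /setUP[yB|/(subsetP sB2') yB]]; last first.
      by rewrite in_setU yB orbT.
    rewrite in_setU; apply/orP; left; apply: (subsetP (sub_closure sD)).
    by rewrite in_setD1 yx.
  - rewrite in_setU negb_or clN //=; apply: contra xe => x2; apply/eqP/onl => //.
    exact: (subsetP sB1').
  - by rewrite setSU.
apply: indep_flats => // x xB.
have [->|xe] := eqVneq x e.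
  (* To separate [e], both bases are taken without it. Both closures miss [e], the only common
     element, so each is the trace of [F] on its side. *)
  pose F := matroid_closure M1 (B1 :\ e) :|: matroid_closure M2 (B2 :\ e).
  have n1 := clN M1 B1 e iB1 eB1; have n2 := clN M2 B2 e iB2 eB2.
  have sD1 : B1 :\ e \subset ground M1 by apply: subset_trans (subD1set _ _) sB1.
  have sD2 : B2 :\ e \subset ground M2 by apply: subset_trans (subD1set _ _) sB2.
  have F1 : F :&: ground M1 = matroid_closure M1 (B1 :\ e).
    rewrite setIUl (setIidPl (sCl _ _)); apply/setUidPl/subsetP => y /setIP[y2 y1].
    by move: (y2); rewrite (only y y1 (subsetP (sCl _ _) _ y2)) (negbTE n2).
  have F2 : F :&: ground M2 = matroid_closure M2 (B2 :\ e).
    rewrite setIUl (setIidPl (sCl M2 _)); apply/setUidPr/subsetP => y /setIP[y1 y2].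
    by move: (y1); rewrite (only y (subsetP (sCl _ _) _ y1) y2) (negbTE n1).
  exists F; split.
  - by rewrite fM F1 F2 !flat_closure // setUSS.
  - by rewrite setDUl setUSS // sub_closure.
  - by rewrite in_setU negb_or n1.
have [xB1|xB1] := boolP (x \in B1).
  have [f1 f2 sF xF sU] := side M1 M2 B1 B2 x iB1 sB1 sB2 eB1 xB1 xe only eE2.
  exists (matroid_closure M1 (B1 :\ x) :|: ground M2); split=> //.
  by rewrite fM sU f1 f2 flat_ground.
have xB2 : x \in B2 by move: xB; rewrite in_setU (negbTE xB1).
have only' y : y \in ground M2 -> y \in ground M1 -> y = e by move=> y2 y1; apply: only.
have [f1 f2 sF xF sU] := side M2 M1 B2 B1 x iB2 sB2 sB1 eB2 xB2 xe only' eE1.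
exists (matroid_closure M2 (B2 :\ x) :|: ground M1); split=> //; last by rewrite setUC.
by rewrite fM (setUC (ground M1)) sU f1 f2 flat_ground.
Qed.

Lemma loopless_rank1 M x : flat M set0 -> x \in ground M -> rank_of M [set x] = 1.
Proof.
move=> /flatP[_ h] xE; have := h x xE; rewrite inE setU0 rank_of0 => /(_ isT) h1.
by apply/eqP; rewrite eqn_leq rank_of1.
Qed.

(** The flat [set0] and the rank bound are carried through the induction: the first gives [e] rank
    one in both parts, the second keeps the truncated subtractions exact. With [0 < l] the uniform
    matroid has rank two. *)
Theorem parallel_connections_card l M :
  parallel_connections_of (uniform 2 (l + 1)) M -> 0 < l ->
  [/\ flat M set0, 2 <= matroid_rank M & #|ground M| = l * (matroid_rank M - 1) + 1].
Proof.
move=> pcM l_gt0; elim: pcM => {M} [M isoM|e M1 M2 M _ [fl1 r1 c1] _ [fl2 r2 c2] pc].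
  have [x0 x0E] : exists x0, x0 \in ground M.
    case: isoM => f [[g fK gK] _].
    have o : 0 < l + 1 by rewrite addn1.
    have oE : Ordinal o \in ground (uniform 2 (l + 1)) by rewrite inE.
    by exists (val (g (exist (fun x => x \in ground (uniform 2 (l + 1))) _ oE))); apply: valP.
  have [g isog] := iso_byP x0E isoM; have [injg img indg] := isog.
  have cM : #|ground M| = l + 1.
    by rewrite -(card_in_imset injg) img cardsT card_ord.
  have indE X : X \subset ground M -> (X \in indep M) = (#|X| <= 2).
    move=> sX; rewrite indg // inE card_in_imset //.
    by apply: sub_in2 injg; apply/subsetP.
  have rM : matroid_rank M = 2.
    apply/eqP; rewrite eqn_leq; apply/andP; split.
      by apply: rank_of_le => I iI sI; rewrite -indE.
    have /card_gt1P[x [y [xE yE xy]]] : 1 < #|ground M| by rewrite cM; lia.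
    have sxy : [set x; y] \subset ground M by rewrite subUset !sub1set xE.
    rewrite -[2]/(true.+1) -xy -cards2; apply: indep_le_rank => //.
    by rewrite indE // cards2 xy.
  split; rewrite ?rM //; last by rewrite muln1.
  apply/flatP; split; rewrite ?sub0set // => x xE _.
  by rewrite setU0 rank_of0 rank_of_indep ?cards1 // indE ?cards1 // sub1set.
have [gI gU fM] := pc.
have eI : e \in ground M1 :&: ground M2 by rewrite gI inE.
have [eE1 eE2] := setIP eI.
have rk := parallel_connection_rank pc (loopless_rank1 fl1 eE1) (loopless_rank1 fl2 eE2).
split; first by rewrite fM !set0I fl1 fl2 sub0set.
  lia.
have := cardsUI (ground M1) (ground M2); rewrite -gU gI cards1 c1 c2.
have -> : matroid_rank M - 1 = (matroid_rank M1 - 1) + (matroid_rank M2 - 1) by lia.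
rewrite mulnDr; lia.
Qed.

End ParallelConnectionRank.

Theorem theorem1p2 (R : realType) (r l : nat) (hr : 1 <= r) (hl : 1 <= l)
    (T : finType) (M : matroid T)
    (M_simple : simple_matroid M)
    (M_rank : matroid_rank M = r)
    (M_positroid : positroid R M)
    (M_no_minor : ~ has_minor M (uniform 2 (l + 2))) :
  #|ground M| <= l * (r - 1) + 1 /\
  (2 <= r ->
     (#|ground M| = l * (r - 1) + 1 <->
      parallel_connections_of (uniform 2 (l + 1)) M)).
Proof.
have adM : admissible l M by split=> //; apply: positroid_noncrossing M_positroid.
split; first by rewrite -M_rank; apply: admissible_card_bound.
move=> r2; split=> [cM|/parallel_connections_card/(_ hl)[_ _]]; last by rewrite M_rank.
have rE : matroid_rank M = (r - 2).+2 by rewrite M_rank; lia.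
have [] // := extremal_structure adM rE.
by rewrite cM; congr (_ * _ + _); lia.
Qed.
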